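(* Let $u\ge1$, $v\ge1$ be real numbers and $a\in\mathbb Z\setminus\{0\}$. Assume the Elliott–Halberstam conjecture for friable numbers (stated in the context). Then $$\#\{1\le n\le x:\ P^+(n)\le x^{1/u}\ \text{and}\ P^+(n+a)\le x^{1/v}\}\ \ge\ \{\varrho(u)\varrho(v)+o(1)\}\,x$$ as $x\to\infty$, where $\varrho$ is Dickman's function.
   Context: $P^+(n)$ denotes the largest prime factor of $n\ge1$, with $P^+(1):=1$ (the finitely many $n$ with $n+a\le0$ are irrelevant). Dickman's function $\varrho$ is the unique function on $[0,\infty)$ that is continuous, differentiable on $(1,\infty)$, equal to $1$ on $[0,1]$, and satisfies $u\varrho'(u)+\varrho(u-1)=0$ for $u>1$. Put $\Psi(x,z;a,q):=\#\{1\le n\le x: P^+(n)\le z,\ n\equiv a\bmod q\}$ and $\Psi_q(x,z):=\#\{1\le n\le x: P^+(n)\le z,\ (n,q)=1\}$; $\varphi$ is Euler's function. Elliott–Halberstam conjecture for friable numbers: let $\varepsilon\in(0,1)$; if the ratio $v=\log x/\log z$ is fixed, then for every $A>0$ $$\sum_{q\le x^{1-\varepsilon}}\ \max_{x'\le x}\ \max_{(a,q)=1}\left|\Psi(x',z;a,q)-\frac{\Psi_q(x',z)}{\varphi(q)}\right|\ \ll_{A,\varepsilon}\ \frac{x}{\log^A x}.$$ *)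

(* Defs.v *)
From HB Require Import structures.
From mathcomp Require Import all_boot all_order all_algebra.
From mathcomp Require Import all_classical all_reals all_analysis.

Set Implicit Arguments.
Unset Strict Implicit.
Unset Printing Implicit Defensive.

Import Order.TTheory GRing.Theory Num.Theory.
Import numFieldNormedType.Exports.

Local Open Scope classical_set_scope.
Local Open Scope ring_scope.

(* #{1 <= n <= x : P n}; [Num.truncn x] is the floor of x if 0 <= x, else 0. *)
Definition count_upto (R : realType) (x : R) (P : pred nat) : nat :=
  count P (index_iota 1 (Num.truncn x).+1).

(* P^+(n) <= z; [max_pdiv] satisfies the convention P^+(1) = 1. *)
Definition friable (R : realType) (z : R) (n : nat) : bool :=
  (max_pdiv n)%:R <= z.

(* Psi(x, z; b, q) *)
Definition Psi_ap (R : realType) (x z : R) (b : int) (q : nat) : nat :=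
  count_upto x (fun n => friable z n && (n%:Z == b %[mod q%:Z])%Z).

(* Psi_q(x, z) *)
Definition Psi_coprime (R : realType) (q : nat) (x z : R) : nat :=
  count_upto x (fun n => friable z n && coprime n q).

(* The maximum over x' <= x and (b, q) = 1. For fixed x, z and q the set is
   finite and nonempty (x' matters only through its integer part, b only
   modulo q), so that the supremum is a maximum. *)
Definition max_discrepancy (R : realType) (x z : R) (q : nat) : \bar R :=
  ereal_sup [set t : \bar R | exists (x' : R) (b : int),
    [/\ x' <= x, coprimez b q%:Z &
        t = (`|(Psi_ap x' z b q)%:R
               - (Psi_coprime q x' z)%:R / (totient q)%:R|)%:E]].

(* The ratio v = log x / log z is fixed, so that the implied constant C may
   depend on v as well as on A and eps. *)
Definition friable_Elliott_Halberstam (R : realType) : Prop :=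
  forall eps v A : R, 0 < eps < 1 -> 1 <= v -> 0 < A ->
  exists C : R, \forall x \near +oo, forall z : R,
    0 < z -> ln x / ln z = v ->
    (\sum_(1 <= q < (Num.truncn (x `^ (1 - eps))).+1) max_discrepancy x z q
       <= (C * (x / ln x `^ A))%:E)%E.

(* Dickman's function, given by its defining properties on [0, +oo[; the
   values of [rho] at negative arguments are irrelevant. *)
Definition is_Dickman (R : realType) (rho : R -> R) : Prop :=
  [/\ {within `[0, +oo[, continuous rho},
      forall w : R, 1 < w -> derivable rho w 1,
      forall w : R, 0 <= w <= 1 -> rho w = 1 &
      forall w : R, 1 < w -> w * derive1 rho w + rho (w - 1) = 0].

(* P^+(n + a) is only defined for n + a >= 1; the finitely many other n are
   not counted. *)
Definition friable_shift_count (R : realType) (x y z : R) (a : int) : nat :=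
  count_upto x (fun n => [&& friable y n, 0 < n%:Z + a
                           & friable z (absz (n%:Z + a))]).

(* Main.v *)
Require Import Defs.
From HB Require Import structures.
From mathcomp Require Import all_boot all_order all_algebra.
From mathcomp Require Import all_classical all_reals all_analysis.
From mathcomp Require Import zify ring lra.

Set Implicit Arguments.
Unset Strict Implicit.
Unset Printing Implicit Defensive.

Import Order.TTheory GRing.Theory Num.Theory.
Import numFieldNormedType.Exports.

Local Open Scope classical_set_scope.
Local Open Scope ring_scope.

(* Let m = n + a with n friable, and z = x^(1/v).  The indicator of "m is
   z-friable" is sum_(d | m) c(d), where c is the Moebius function restricted to
   integers all of whose primes exceed z (z-rough integers).  Divisors
   d <= x^(1-e) are handled by the Elliott-Halberstam hypothesis.  If m has a
   z-rough divisor d > x^(1-e), then its cofactor is < x^(2e), so m has no prime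
   factor in ]x^(2e), x^(1/(3v))]; the number of such primes dividing m has mean
   and variance about log(1/e) by a second moment (Turan-Kubilius) computation,
   hence such m are rare when e is small.  Running the same argument on all m <= x
   shows that the sum of c(d)/d, d <= x^(1-e), is close to Psi(x, z)/x, so that
   the count is close to Psi(x, x^(1/u)) Psi(x, z) / x.

   Dickman's theorem Psi(x, x^(1/u)) ~ rho(u) x is obtained from Buchstab's
   identity and Mertens' theorem on the sum of 1/p.  Integrals are avoided by
   comparing over short intervals [s, t] of the parameter: the error there is
   (t - s) times the increment of a monotone function, so that the errors
   accumulated over a subdivision of mesh h add up to O(h). *)

(** * Chebyshev's bound and Mertens' first theorem *)

(** The obstacle is the range d > x^(1-e), where the hypothesis says nothing. The bound obtained
    there is only a small multiple of x, not o(x); so e is fixed in terms of the tolerance and of v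
    before x grows, and every other error is o(x) with constants that may depend on e. All sums over
    divisors are kept under control by one uniform count: an integer below z^k has at most 2^k
    z-rough divisors. As z is a fixed power of x, k stays fixed, and so do the bound on c(d) and the
    number of terms that each m contributes. Working with rough moduli also simplifies the main
    term. Once x^(2e) is at least |a|, such moduli are coprime to a, and phi(d)/d differs from 1 by
    O(x^(-2e)), so that Psi_d(x, y)/phi(d) can be replaced by Psi(x, y)/d; the factor log x lost on
    summing 1/d is absorbed by the power of x. *)

Lemma prod_primes_dvdn (s : seq nat) (N : nat) :
  uniq s -> all prime s -> all (dvdn^~ N) s -> (\prod_(p <- s) p %| N)%N.
Proof.
elim: s => [|p s IHs]; first by rewrite big_nil dvd1n.
move=> /= /andP[ps us] /andP[p_pr s_pr] /andP[pN sN].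
rewrite big_cons Gauss_dvd ?pN ?IHs// prime_coprime// Euclid_dvd_prod// big_has.
apply/hasPn => q qs; rewrite dvdn_prime2 ?(allP s_pr _ qs)//.
by apply: contraNneq ps => ->.
Qed.

Lemma leq_bin_exp2 n k : ('C(n, k) <= 2 ^ n)%N.
Proof.
have [kn|nk] := leqP k n; last by rewrite bin_small.
have -> : (2 ^ n = (1 + 1) ^ n)%N by [].
rewrite expnDn (bigD1 (inord k)) //= !exp1n inordK ?ltnS// !muln1.
exact: leq_addr.
Qed.

Definition primorial n := (\prod_(1 <= p < n.+1 | prime p) p)%N.

(* The primes in (n/2, n] all divide the middle binomial coefficient. *)
Lemma primorial_uphalf n : (primorial n <= primorial (uphalf n) * 2 ^ n)%N.
Proof.
have hn : (uphalf n <= n)%N by lia.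
rewrite /primorial (@big_cat_nat _ _ _ (uphalf n).+1)//= leq_mul2l; apply/orP; right.
apply: leq_trans (leq_bin_exp2 n (uphalf n)).
rewrite -big_filter; apply: dvdn_leq; first by rewrite bin_gt0.
apply: prod_primes_dvdn.
- by rewrite filter_uniq// iota_uniq.
- exact: filter_all.
apply/allP => p; rewrite mem_filter mem_index_iota => /and3P[p_pr hp pn].
have : (p %| 'C(n, uphalf n) * ((uphalf n)`! * (n - uphalf n)`!))%N.
  rewrite bin_fact// dvdn_fact//; have := prime_gt0 p_pr; lia.
rewrite Euclid_dvdM// => /orP[//|].
by rewrite Euclid_dvdM// !fact_prod !Euclid_dvd_prod// !big_has => /orP[]/hasP[i];
  rewrite mem_index_iota => ilt pi; have := dvdn_leq _ pi; lia.
Qed.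

Lemma primorial_le n : (primorial n <= 16 ^ n)%N.
Proof.
elim/ltn_ind: n => n IHn; have [n1|n2] := leqP n 1.
  by case: n n1 {IHn} => [|[|//]] _; rewrite /primorial unlock.
apply: leq_trans (primorial_uphalf n) _.
have h1 : (uphalf n < n)%N by lia.
apply: leq_trans (leq_mul (IHn _ h1) (leqnn _)) _.
(* With 16 = 2^4 the induction needs 4 * uphalf n + n <= 4 * n, true for n >= 2. *)
by rewrite -[16%N]/(2 ^ 4)%N -!expnM -expnD leq_exp2l//; lia.
Qed.

Section Mertens.
Variable R : realType.
Implicit Types n m p : nat.

Lemma ln_nat_ge0 n : (0 < n)%N -> 0 <= ln (n%:R : R).
Proof. by move=> n0; apply: ln_ge0; rewrite ler1n. Qed.

Lemma ln_prod (I : eqType) (s : seq I) (P : pred I) (F : I -> R) :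
  (forall i, P i -> 0 < F i) ->
  ln (\prod_(i <- s | P i) F i) = \sum_(i <- s | P i) ln (F i).
Proof.
move=> F0; elim: s => [|i s IHs]; first by rewrite !big_nil ln1.
rewrite !big_cons; case: ifP => // Pi.
by rewrite lnM ?IHs// posrE ?F0// prodr_gt0.
Qed.

Lemma chebyshev_theta_le n :
  \sum_(1 <= p < n.+1 | prime p) ln (p%:R : R) <= n%:R * ln 16.
Proof.
rewrite -ln_prod; last by move=> p /prime_gt0; rewrite ltr0n.
rewrite mulr_natl -lnXn// -natr_prod -[16]/(16%:R) -natrX.
rewrite ler_ln ?posrE ?ltr0n ?expn_gt0// ?ler_nat; first exact: primorial_le.
by rewrite prodn_cond_gt0// => p /prime_gt0.
Qed.

Lemma ln_nat_decomp n m : (0 < m <= n)%N ->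
  ln (m%:R : R) = \sum_(1 <= p < n.+1 | prime p) (logn p m)%:R * ln p%:R.
Proof.
case/andP=> m0 mn.
have -> : m%:R = \prod_(1 <= p < n.+1 | prime p) (p%:R ^+ logn p m) :> R.
  rewrite -{1}(partnT m0) (widen_partn _ mn) big_mkcond/= big_ltn//=.
  rewrite lognE /= mul1n natr_prod [in RHS]big_mkcond/=.
  apply: eq_bigr => p _; rewrite natrX.
  by case: ifP => //; rewrite lognE => ->.
rewrite ln_prod; last by move=> p /prime_gt0 p0; rewrite exprn_gt0// ltr0n.
by apply: eq_bigr => p /prime_gt0 p0; rewrite lnXn ?ltr0n// mulr_natl.
Qed.

Lemma sum_ln_le n : \sum_(1 <= m < n.+1) ln (m%:R : R) <= n%:R * ln n%:R.
Proof.
have -> : n%:R * ln n%:R = \sum_(1 <= m < n.+1) ln (n%:R : R).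
  by rewrite sumr_const_nat subn1 mulr_natl.
by apply: ler_sum_nat => m /andP[m0 mn]; rewrite ler_ln ?posrE ?ltr0n ?ler_nat//; lia.
Qed.

Lemma lnS_sub_le n : (0 < n)%N -> ln n.+1%:R - ln n%:R <= n%:R^-1 :> R.
Proof.
move=> n0; rewrite -ln_div ?posrE ?ltr0n//.
have n0' : n%:R != 0 :> R by rewrite pnatr_eq0 -lt0n.
have -> : n.+1%:R / n%:R = 1 + n%:R^-1 :> R.
  by rewrite -natr1; field.
by apply: le_ln1Dx; apply: lt_le_trans (_ : 0 <= _); rewrite ?ltrN10 ?invr_ge0.
Qed.

(** With [sum_ln_le], this is Stirling's formula up to O(n), the precision needed for Mertens'
    theorem. *)
Lemma sum_ln_ge n :
  n%:R * ln n%:R - n%:R <= \sum_(1 <= m < n.+1) ln (m%:R : R).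
Proof.
elim: n => [|n IHn]; first by rewrite big_nil mul0r subr0.
rewrite big_nat_recr//=; have [->|n0] := posnP n.
  by rewrite big_nil ln1; lra.
apply: le_trans (lerD IHn (lexx _)).
have := lnS_sub_le n0; rewrite -(ler_pM2l (_ : 0 < n%:R :> R)) ?ltr0n//.
rewrite mulfV ?pnatr_eq0 -?lt0n// -natr1; lra.
Qed.

Lemma logn_fact_ge p n : prime p -> (n %/ p <= logn p n`!)%N.
Proof.
move=> pp; rewrite logn_fact//; have [->|n0] := posnP n; first by rewrite div0n.
by rewrite big_ltn// expn1 leq_addr.
Qed.

Lemma logn_fact_le p n : prime p -> (logn p n`!)%:R <= n%:R / (p%:R - 1) :> R.
Proof.
move=> pp; rewrite logn_fact// natr_sum.
have p1 : 1 < p%:R :> R by rewrite ltr1n prime_gt1.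
(* Keeping the exact partial sum of the geometric series makes the induction close. *)
have H K : \sum_(1 <= k < K.+1) (n %/ p ^ k)%:R
    <= n%:R / (p%:R - 1) * (1 - p%:R ^- K) :> R.
  elim: K => [|K IHK]; first by rewrite big_nil expr0 invr1 subrr mulr0.
  rewrite big_nat_recr//=; apply: le_trans (lerD IHK (_ : _ <= n%:R / p%:R ^+ K.+1)) _.
    rewrite ler_pdivlMr ?exprn_gt0//; last lra.
    by rewrite -natrX -natrM ler_nat leq_trunc_div.
  have pK : p%:R ^+ K != 0 :> R by rewrite expf_neq0//; lra.
  rewrite exprS le_eqVlt; apply/orP; left; apply/eqP.
  by field; rewrite pK andTb; apply/andP; split; lra.
by apply: le_trans (H n) _; rewrite ler_piMr ?divr_ge0 ?subr_ge0 ?(ltW p1)//.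
Qed.

Lemma sum_ln_fact n : \sum_(1 <= m < n.+1) ln (m%:R : R) =
  \sum_(1 <= p < n.+1 | prime p) (logn p n`!)%:R * ln p%:R.
Proof.
rewrite (eq_big_nat _ _ (F2 := fun m =>
   \sum_(1 <= p < n.+1 | prime p) (logn p m)%:R * ln p%:R)); last first.
  by move=> m /andP[m0 mn]; apply: ln_nat_decomp; rewrite m0.
rewrite exchange_big/=; apply: eq_bigr => p pp; rewrite -mulr_suml -natr_sum.
congr (_%:R * _); rewrite fact_prod.
have : all (fun i => 0 < i)%N (index_iota 1 n.+1).
  by apply/allP => i; rewrite mem_index_iota => /andP[].
elim: (index_iota _ _) => [|i s IHs]/=; first by rewrite !big_nil logn1.
case/andP=> i0 s0; rewrite !big_cons lognM ?IHs//.
by rewrite big_seq prodn_cond_gt0// => j /(allP s0).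
Qed.

(** A telescoping majorant: -(ln t + 1)/t is a primitive of (ln t)/t^2, and the constant 2 in place
    of 1 absorbs the passage from derivatives to differences. *)
Lemma ln_div_mul_pred_le m : (1 < m)%N ->
  ln m%:R / (m%:R * (m%:R - 1)) <=
  (ln m.-1%:R + 2) / m.-1%:R - (ln m%:R + 2) / m%:R :> R.
Proof.
case: m => [//|[//|k _]] /=.
have := @lnS_sub_le k.+1 isT.
set a := ln k.+2%:R; set b := ln k.+1%:R => ab.
have -> : k.+2%:R - 1 = k.+1%:R :> R by rewrite -[in LHS]natr1 addrK.
have k1 : 0 < k.+1%:R :> R by rewrite ltr0n.
have k2 : 0 < k.+2%:R :> R by rewrite ltr0n.
have e : (b + 2) / k.+1%:R - (a + 2) / k.+2%:R =
   (a + (2 - k.+2%:R * (a - b))) / (k.+2%:R * k.+1%:R).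
  have k2E : k.+2%:R = k.+1%:R + 1 :> R by rewrite natr1.
  move: k1 k2; rewrite k2E; move: (k.+1%:R) => c c0 c1.
  by field; apply/andP; split; apply: lt0r_neq0.
rewrite e ler_pM2r ?invr_gt0 ?mulr_gt0// lerDl subr_ge0.
have h := ler_wpM2l (ltW k2) ab; apply: le_trans h _.
rewrite ler_pdivrMr// -natrM ler_nat; lia.
Qed.

Lemma sum_ln_div_mul_pred_le n :
  \sum_(1 <= p < n.+1 | prime p) ln p%:R / (p%:R * (p%:R - 1)) <= 2 :> R.
Proof.
have [->|n0] := posnP n; first by rewrite big_nil.
apply: (@le_trans _ _ (\sum_(2 <= m < n.+1)
   ((ln m.-1%:R + 2) / m.-1%:R - (ln m%:R + 2) / m%:R))).
  rewrite big_ltn_cond//= big_mkcond/=; apply: ler_sum_nat => m /andP[m1 _].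
  apply: le_trans (ln_div_mul_pred_le m1); case: ifP => // _.
  have m1' : 1 <= m%:R :> R by rewrite ler1n; lia.
  by rewrite divr_ge0 ?mulr_ge0 ?ln_ge0 ?subr_ge0//; apply: le_trans m1'.
have -> : \sum_(2 <= m < n.+1)
   ((ln m.-1%:R + 2) / m.-1%:R - (ln m%:R + 2) / m%:R) =
   2 - (ln n%:R + 2) / n%:R :> R.
  elim: n n0 => [//|[|n] IHn] _; first by rewrite big_geq// ln1; lra.
  rewrite big_nat_recr//= IHn//. ring.
by rewrite gerBl divr_ge0// addr_ge0// ln_nat_ge0.
Qed.

Definition mertens_sum n : R := \sum_(1 <= p < n.+1 | prime p) ln p%:R / p%:R.

(** The exponent of p in n! is at least n/p - 1; dropping the 1 costs ln p for each prime, hence at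
    most n ln 16 by Chebyshev's bound. *)
Lemma mertens_sum_le n : (0 < n)%N -> mertens_sum n <= ln n%:R + ln 16.
Proof.
move=> n0; have n0' : 0 < n%:R :> R by rewrite ltr0n.
have := sum_ln_le n; rewrite sum_ln_fact => H.
have : \sum_(1 <= p < n.+1 | prime p) (n%:R / p%:R - 1) * ln p%:R
    <= n%:R * ln n%:R :> R.
  apply: le_trans H; apply: ler_sum => p pp; rewrite ler_wpM2r ?ln_nat_ge0 ?prime_gt0//.
  apply: le_trans (_ : (n %/ p)%:R <= _); last by rewrite ler_nat logn_fact_ge.
  rewrite lerBlDr natr1 ler_pdivrMr ?ltr0n ?prime_gt0// -natrM ler_nat.
  by rewrite ltnW// ltn_ceil// prime_gt0.
under eq_bigr do rewrite mulrBl mul1r -mulrA (mulrC _^-1).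
rewrite big_split/= sumrN -mulr_sumr => {}H.
rewrite -(ler_pM2l n0'); have := chebyshev_theta_le n; rewrite /mertens_sum; lra.
Qed.

(** The exponent of p in n! is at most n/(p-1) = n/p + n/(p(p-1)). The 3 is 1 from Stirling's
    formula plus 2 from the sum of ln p/(p(p-1)). *)
Lemma mertens_sum_ge n : (0 < n)%N -> ln n%:R - 3 <= mertens_sum n.
Proof.
move=> n0; have n0' : 0 < n%:R :> R by rewrite ltr0n.
have := sum_ln_ge n; rewrite sum_ln_fact => H.
have : \sum_(1 <= p < n.+1 | prime p) (logn p n`!)%:R * ln p%:R <=
   n%:R * (mertens_sum n + \sum_(1 <= p < n.+1 | prime p) ln p%:R / (p%:R * (p%:R - 1))).
  rewrite /mertens_sum -big_split/= mulr_sumr; apply: ler_sum => p pp.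
  apply: le_trans (ler_wpM2r (ln_nat_ge0 (prime_gt0 pp)) (logn_fact_le n pp)) _.
  have p1 : 1 < p%:R :> R by rewrite ltr1n prime_gt1.
  rewrite le_eqVlt; apply/orP; left; apply/eqP; field.
  by apply/andP; split; lra.
have := sum_ln_div_mul_pred_le n; rewrite -(ler_pM2l n0') => h1 h2.
rewrite -(ler_pM2l n0'); move: H h1 h2; rewrite mulrDr; lra.
Qed.

End Mertens.

(** * Sums of 1/p over x^(1/t) < p <= x^(1/s) *)

Section Creep.
Variable R : realType.

(** [E s e] is to be read as: the deviation at s is at most e. With steps of equal length h the
    increments of g telescope to h (g T - g s0). *)
Lemma creep_steps (E : R -> R -> Prop) (g : R -> R) (s0 T : R) :
  s0 < T -> E s0 0 ->
  (forall s t e, s0 <= s -> s < t -> t <= T -> 0 <= e -> E s e ->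
     E t (e + (t - s) * (g t - g s))) ->
  (forall s t, s0 <= s -> s <= t -> t <= T -> g s <= g t) ->
  forall n, E T ((T - s0) / n.+1%:R * (g T - g s0)).
Proof.
move=> sT E0 step gmono n; set h := (T - s0) / n.+1%:R.
have n0 : 0 < n.+1%:R :> R by rewrite ltr0n.
have h0 : 0 < h by rewrite divr_gt0// subr_gt0.
have hT : s0 + n.+1%:R * h = T.
  by rewrite /h mulrC -mulrA mulVf ?mulr1 ?lt0r_neq0//; ring.
suff H i : (i <= n.+1)%N -> E (s0 + i%:R * h) (h * (g (s0 + i%:R * h) - g s0)).
  by have := H n.+1 (leqnn _); rewrite hT.
elim: i => [_|i IHi ilt]; first by rewrite mul0r addr0 subrr mulr0.
have ih : s0 <= s0 + i%:R * h by rewrite lerDl mulr_ge0 ?ler0n ?(ltW h0).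
have iSh : s0 + i%:R * h < s0 + i.+1%:R * h.
  by rewrite ltrD2l ltr_pM2r// ltr_nat.
have iST : s0 + i.+1%:R * h <= T by rewrite -hT lerD2l ler_pM2r// ler_nat.
have := step _ _ _ ih iSh iST _ (IHi (ltnW ilt)).
have -> : s0 + i.+1%:R * h - (s0 + i%:R * h) = h by rewrite -natr1; ring.
rewrite -mulrDr (addrC (g _ - g s0)) addrA subrK; apply.
by rewrite mulr_ge0 ?(ltW h0)// subr_ge0 gmono// (le_trans (ltW iSh)).
Qed.

(* A deviation that grows by at most (t - s) (g t - g s) from s to t is
   infinitesimal: cut [s0, T] into n equal steps and let n grow. *)
Lemma creep (E : R -> R -> Prop) (g : R -> R) (s0 T : R) :
  s0 < T -> E s0 0 ->
  (forall s t e, s0 <= s -> s < t -> t <= T -> 0 <= e -> E s e ->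
     E t (e + (t - s) * (g t - g s))) ->
  (forall s t, s0 <= s -> s <= t -> t <= T -> g s <= g t) ->
  (forall e e', e <= e' -> E T e -> E T e') ->
  forall e, 0 < e -> E T e.
Proof.
move=> sT E0 step gmono wk e e0.
have H := creep_steps sT E0 step gmono.
set c := (T - s0) * (g T - g s0).
have c0 : 0 <= c by rewrite mulr_ge0 ?subr_ge0 ?gmono// ltW.
apply: wk (H (Num.truncn (c / e))).
rewrite mulrAC -/c ler_pdivrMr ?ltr0n// mulrC -ler_pdivrMr//.
by rewrite ltW// truncnS_gt.
Qed.

(** This says limsup |f - l| <= e at infinity. Allowing e > 0 lets deviations be added up over a
    subdivision before the mesh tends to 0. *)
Definition near_limit (f : R -> R) (l e : R) :=
  forall eta, 0 < eta -> \forall x \near +oo, `|f x - l| <= e + eta.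

Lemma near_limit_le f l e e' : e <= e' -> near_limit f l e -> near_limit f l e'.
Proof.
move=> ee fl eta eta0; apply: filterS (fl _ eta0) => x /le_trans; apply.
by rewrite lerD2r.
Qed.

Lemma near_limit0 f l : (forall e, 0 < e -> near_limit f l e) -> near_limit f l 0.
Proof.
move=> H eta eta0; have eta2 : 0 < eta / 2 by lra.
by apply: filterS (H _ eta2 _ eta2) => x; rewrite add0r -splitr.
Qed.

Lemma ln_diff_bounds (s t : R) : 0 < s -> 0 < t ->
  1 - s / t <= ln t - ln s <= t / s - 1.
Proof.
move=> s0 t0; rewrite -ln_div ?posrE//; apply/andP; split; last first.
  have := @le_ln1Dx R (t / s - 1); rewrite [1 + _]addrC subrK; apply.
  by rewrite ltrBrDr addNr divr_gt0.
have := @le_ln1Dx R (s / t - 1); rewrite [1 + _]addrC subrK.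
rewrite -[s / t]invf_div lnV ?posrE ?divr_gt0//.
have -> : -1 < (t / s)^-1 - 1 by rewrite ltrBrDr addNr invr_gt0 divr_gt0.
by move=> /(_ isT); lra.
Qed.

End Creep.

Section MertensBlocks.
Variable R : realType.

(* x^(1/t) < p <= x^(1/s) *)
Definition block (x s t : R) (p : nat) : bool :=
  (p%:R `^ s <= x) && (x < p%:R `^ t).

Definition block_sum (x s t : R) : R :=
  \sum_(1 <= p < (Num.truncn x).+1 | prime p && block x s t p) p%:R^-1.

Lemma powR_inv_le (x s c : R) : 0 < s -> 0 <= c -> 0 <= x ->
  (c `^ s <= x) = (c <= x `^ s^-1).
Proof.
move=> s0 c0 x0; apply/idP/idP => h.
  have := @ge0_ler_powR R s^-1 _ (c `^ s) x.
  rewrite invr_ge0 (ltW s0) !nnegrE powR_ge0 x0 -powRrM mulfV ?lt0r_neq0// powRr1//.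
  by apply.
have := @ge0_ler_powR R s _ c (x `^ s^-1).
rewrite (ltW s0) !nnegrE powR_ge0 c0 -powRrM mulVf ?lt0r_neq0// powRr1//.
by apply.
Qed.

Lemma block_truncn (x s t : R) p : 0 < s -> 0 < t -> 0 <= x ->
  block x s t p =
  (Num.truncn (x `^ t^-1) < p <= Num.truncn (x `^ s^-1))%N.
Proof.
move=> s0 t0 x0; rewrite /block powR_inv_le// ltNge powR_inv_le// -ltNge andbC.
by rewrite truncn_ge_nat ?powR_ge0// truncn_lt_nat ?powR_ge0.
Qed.

Lemma truncn_root_le (x s : R) : 1 <= s -> 1 <= x ->
  (Num.truncn (x `^ s^-1) <= Num.truncn x)%N.
Proof. by move=> s1 x1; apply: le_truncn; rewrite ler1_powR// invf_le1//; lra. Qed.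

Lemma big_block (x s t : R) (F : nat -> R) : 1 <= s -> s <= t -> 1 <= x ->
  \sum_(1 <= p < (Num.truncn x).+1 | prime p && block x s t p) F p =
  \sum_((Num.truncn (x `^ t^-1)).+1 <= p < (Num.truncn (x `^ s^-1)).+1 | prime p) F p.
Proof.
move=> s1 st x1.
have -> : index_iota (Num.truncn (x `^ t^-1)).+1 (Num.truncn (x `^ s^-1)).+1 =
  [seq p <- index_iota 1 (Num.truncn x).+1 | block x s t p].
  have [s0 t0 x0] : [/\ 0 < s, 0 < t & 0 <= x] by split; lra.
  rewrite (eq_filter (fun p => block_truncn p s0 t0 x0)).
  apply: (irr_sorted_eq ltn_trans ltnn); rewrite ?iota_ltn_sorted//.
    exact/sorted_filter/iota_ltn_sorted/ltn_trans.
  have := truncn_root_le s1 x1.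
  by move=> h p; rewrite mem_filter !mem_index_iota; lia.
by rewrite big_filter_cond; apply: eq_bigl => p; rewrite andbC.
Qed.

Lemma mertens_sum_truncn (w : R) : 1 <= w ->
  `|mertens_sum R (Num.truncn w) - ln w| <= 3 + ln 16.
Proof.
move=> w1; have n0 : (0 < Num.truncn w)%N by rewrite truncn_gt0.
have := mertens_sum_le R n0; have := mertens_sum_ge R n0.
set n := Num.truncn w in n0 *; set M := mertens_sum R n => h1 h2.
have /andP[nw wn] : n%:R <= w < n.+1%:R by rewrite truncn_itv//; lra.
have n0' : 0 < n%:R :> R by rewrite ltr0n.
have k1 : ln n%:R <= ln w by rewrite ler_ln// posrE; lra.
have k2 : ln w <= ln n.+1%:R by rewrite ler_ln ?posrE ?ltr0n//; lra.
have k3 := @lnS_sub_le R n n0.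
have k4 : n%:R^-1 <= 1 :> R by rewrite invf_le1// ler1n.
have ge0 : 0 <= ln 16 :> R by apply: ln_ge0; lra.
(* Passing from w to its floor costs at most 1, which ln 16 absorbs. The inequality exp(1) <= 16
   follows from exp(-1/2) >= 1/2. *)
have ge1 : 1 <= ln 16 :> R.
  apply: le_trans (_ : ln (expR 1) <= _); first by rewrite expRK.
  rewrite ler_ln ?posrE ?expR_gt0//.
  have := @expR_ge1Dx R (- (1/2)); have := expR_gt0 (1/2 : R).
  have -> : expR 1 = expR (1 / 2) * expR (1 / 2) :> R by rewrite -expRD; congr expR; lra.
  have := expRxMexpNx_1 (1/2 : R); set a := expR _; set b := expR _.
  by nra.
by rewrite ler_norml; apply/andP; split; lra.
Qed.

(** On a block, ln p lies between ln x/t and ln x/s, so 1/p is ln p/p times a factor between s/ln x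
    and t/ln x; Mertens' first theorem at both ends evaluates the sum of ln p/p. *)
Lemma block_sum_bounds (x s t : R) : 1 <= s -> s < t -> 1 < x ->
  1 - s / t - 2 * (3 + ln 16) * s / ln x <= block_sum x s t
    <= t / s - 1 + 2 * (3 + ln 16) * t / ln x.
Proof.
move=> s1 st x1; rewrite /block_sum big_block//; try lra.
have lx : 0 < ln x by apply: ln_gt0.
have lr (r : R) : ln (x `^ r^-1) = ln x / r by rewrite ln_powR mulrC.
have root1 (r : R) : 1 <= r -> 1 <= x `^ r^-1.
  by move=> r1; rewrite -(powRr0 x) ler_powR ?invr_ge0//; lra.
set n1 := Num.truncn (x `^ t^-1); set n2 := Num.truncn (x `^ s^-1).
have n12 : (n1 <= n2)%N.
  apply: le_truncn; rewrite ler_powR ?(ltW x1)// lef_pV2 ?posrE; lra.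
have e : \sum_(n1.+1 <= p < n2.+1 | prime p) ln p%:R / p%:R =
   mertens_sum R n2 - mertens_sum R n1.
  rewrite /mertens_sum (@big_cat_nat _ _ _ n1.+1 1%N n2.+1)//=; lra.
have := mertens_sum_truncn (root1 t _); rewrite -/n1 lr => /(_ ltac:(lra)).
have := mertens_sum_truncn (root1 s s1); rewrite -/n2 lr.
rewrite !ler_norml => /andP[a1 a2] /andP[b1 b2].
have pb p : (n1.+1 <= p < n2.+1)%N -> ln x / t <= ln p%:R <= ln x / s.
  move=> /andP[p1 p2]; have p0 : (0 < p)%N by lia.
  rewrite -!lr !ler_ln ?posrE ?ltr0n ?powR_gt0//; try lra.
  apply/andP; split.
    by rewrite ltW// -truncn_lt_nat ?powR_ge0.
  by rewrite -truncn_ge_nat ?powR_ge0.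
have up : \sum_(n1.+1 <= p < n2.+1 | prime p) p%:R^-1 <=
   t / ln x * \sum_(n1.+1 <= p < n2.+1 | prime p) (ln p%:R / p%:R) :> R.
  rewrite mulr_sumr big_nat_cond [leRHS]big_nat_cond; apply: ler_sum => p /andP[/pb/andP[h _] pp].
  rewrite mulrA ler_peMl ?invr_ge0// mulrAC ler_pdivlMr// mul1r mulrC -ler_pdivrMr//; lra.
have lo : s / ln x * \sum_(n1.+1 <= p < n2.+1 | prime p) (ln p%:R / p%:R) <=
   \sum_(n1.+1 <= p < n2.+1 | prime p) p%:R^-1 :> R.
  rewrite mulr_sumr big_nat_cond [leRHS]big_nat_cond; apply: ler_sum => p /andP[/pb/andP[_ h] pp].
  rewrite mulrA ler_piMl ?invr_ge0// mulrAC ler_pdivrMr// mul1r mulrC -ler_pdivlMr//; lra.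
set K := 3 + ln 16 in a1 a2 b1 b2 *.
apply/andP; split.
  apply: le_trans lo; rewrite e.
  apply: le_trans (ler_wpM2l _ (_ : ln x / s - ln x / t - 2 * K <= _)); last by lra.
    rewrite le_eqVlt; apply/orP; left; apply/eqP; field.
    by rewrite !lt0r_neq0//; lra.
  by rewrite divr_ge0//; lra.
apply: le_trans up _; rewrite e.
apply: le_trans (ler_wpM2l _ (_ : _ <= ln x / s - ln x / t + 2 * K)) _; last first.
    rewrite le_eqVlt; apply/orP; left; apply/eqP; field.
    by rewrite !lt0r_neq0//; lra.
  lra.
by rewrite divr_ge0//; lra.
Qed.

Lemma block_sum_cat (x s r t : R) : 1 <= s -> s <= r -> r <= t -> 1 <= x ->
  block_sum x s t = block_sum x s r + block_sum x r t.
Proof.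
move=> s1 sr rt x1; rewrite /block_sum !big_block//; try lra.
by rewrite addrC -big_cat_nat//= ltnS le_truncn// ler_powR// lef_pV2 ?posrE; lra.
Qed.

Lemma div_ln_small (K eta : R) : 0 < eta ->
  \forall x \near +oo, K / ln x <= eta.
Proof.
move=> eta0; near=> x.
have lx : Num.max 1 (K / eta) <= ln x.
  have ex : expR (Num.max 1 (K / eta)) <= x.
    by near: x; apply: nbhs_pinfty_ge; rewrite num_real.
  by rewrite -[leLHS]expRK ler_ln ?posrE ?expR_gt0// (lt_le_trans _ ex) ?expR_gt0.
have [l1 l2] : 1 <= ln x /\ K / eta <= ln x by move: lx; rewrite ge_max => /andP[].
by rewrite ler_pdivrMr; [rewrite mulrC -ler_pdivrMr|lra].
Unshelve. all: end_near. Qed.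

(** On a short block [a, b] both the sum and ln b - ln a lie, up to o(1), between 1 - a/b and b/a -
    1. These differ by (b-a)^2/(ab), which is quadratic in the length, so [creep] applies with the
    identity as g. *)
Lemma block_sum_limit (s t : R) : 1 <= s -> s < t ->
  near_limit (fun x => block_sum x s t) (ln t - ln s) 0.
Proof.
move=> s1 st; apply: near_limit0 => e e0.
apply: (creep (E := fun t e => near_limit (fun x => block_sum x s t) (ln t - ln s) e)
   (g := id) st) => //.
- move=> eta eta0; near=> x.
  rewrite /block_sum big1 ?subrr ?normr0 ?add0r; first exact: ltW.
  by move=> p /andP[_ /andP[/le_lt_trans h /h]]; rewrite ltxx.
- move=> a b f sa ab bt f0 H eta eta0; near=> x.
  have x1 : 1 < x by near: x; apply: nbhs_pinfty_gt; rewrite num_real.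
  have h1 : `|block_sum x s a - (ln a - ln s)| <= f + eta / 2.
    by near: x; apply: H; lra.
  rewrite (@block_sum_cat x s a b)//; try lra.
  have h2 : 2 * (3 + ln 16) * a / ln x <= eta / 2.
    by near: x; apply: div_ln_small; lra.
  have h3 : 2 * (3 + ln 16) * b / ln x <= eta / 2.
    by near: x; apply: div_ln_small; lra.
  have /andP[h4 h5] := block_sum_bounds (le_trans s1 sa) ab x1.
  have /andP[h6 h7] := @ln_diff_bounds R a b ltac:(lra) ltac:(lra).
  have h8 : (b / a - 1) - (1 - a / b) <= (b - a) * (b - a).
    have -> : (b / a - 1) - (1 - a / b) = (b - a) * (b - a) / (a * b).
      by field; apply/andP; split; lra.
    by rewrite ler_piMr ?mulr_ge0 ?subr_ge0 ?(ltW ab)// invf_le1; nra.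
  by move: h1; rewrite !ler_norml => /andP[? ?]; apply/andP; split; lra.
- by move=> e1 e2; apply: near_limit_le.
Unshelve. all: end_near. Qed.

End MertensBlocks.

(** * Dickman's theorem *)

Lemma count_multiples (N d : nat) (Q : pred nat) : (0 < d)%N ->
  count (fun n => (d %| n)%N && Q n) (index_iota 1 N.+1) =
  count (fun m => Q (d * m)%N) (index_iota 1 (N %/ d).+1).
Proof.
move=> d0.
rewrite -(count_map (muln d) Q) (eq_count (a2 := predI Q (dvdn d))); last first.
  by move=> n /=; rewrite andbC.
rewrite -count_filter; apply/permP/uniq_perm.
- by rewrite filter_uniq ?iota_uniq.
- rewrite map_inj_uniq ?iota_uniq// => m n /eqP.
  by rewrite eqn_pmul2l// => /eqP.
move=> n; rewrite mem_filter mem_index_iota; apply/idP/mapP.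
  move=> /andP[/dvdnP[k ->] h]; exists k; last by rewrite mulnC.
  rewrite mem_index_iota ltnS leq_divRL//; lia.
case=> m; rewrite mem_index_iota ltnS leq_divRL// => h ->.
rewrite dvdn_mulr//=; nia.
Qed.

Lemma max_pdiv_primeM p m : prime p -> (0 < m)%N ->
  (max_pdiv (p * m) == p) = (max_pdiv m <= p)%N.
Proof.
move=> pp m0; have p0 := prime_gt0 pp; have p1 := prime_gt1 pp.
have pm1 : (1 < p * m)%N by nia.
have Mpr := max_pdiv_prime pm1; apply/eqP/idP => [<-|h].
  have [m1|m1] := leqP m 1.
    by have -> : m = 1%N by lia.
  apply: max_pdiv_max; rewrite mem_primes max_pdiv_prime// muln_gt0 p0 m0/=.
  by rewrite dvdn_mull// max_pdiv_dvd.
apply/eqP; rewrite eqn_leq; apply/andP; split; last first.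
  by apply: max_pdiv_max; rewrite mem_primes pp muln_gt0 p0 m0 dvdn_mulr.
have := max_pdiv_dvd (p * m); rewrite Euclid_dvdM// => /orP[|].
  exact: dvdn_leq.
move=> Mm; apply: leq_trans h; apply: max_pdiv_max.
by rewrite mem_primes Mpr m0.
Qed.

Lemma count_fiberwise (T : Type) (U : eqType) (s : seq T) (r : seq U) (f : T -> U)
    (Q : pred T) : uniq r -> (forall n, Q n -> f n \in r) ->
  count Q s = (\sum_(p <- r) count (fun n => Q n && (f n == p)) s)%N.
Proof.
move=> ur Qr; elim: s => [|n s IHs] /=; first by rewrite big1.
rewrite big_split/= -IHs; congr (_ + _)%N; case: (boolP (Q n)) => [Qn|_]/=; last by rewrite big1.
under eq_bigr do rewrite eq_sym.
by rewrite -big_mkcond sum1_count/= count_uniq_mem// Qr.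
Qed.

Section Dickman.
Variable R : realType.

Lemma truncn_div (x : R) d : 0 <= x -> (0 < d)%N ->
  Num.truncn (x / d%:R) = (Num.truncn x %/ d)%N.
Proof.
move=> x0 d0; have d0' : 0 < d%:R :> R by rewrite ltr0n.
have /andP[h1 h2] := truncn_itv x0; apply: truncn_def.
rewrite ler_pdivlMr// ltr_pdivrMr// -!natrM; apply/andP; split.
  by apply: le_trans h1; rewrite ler_nat leq_trunc_div.
by apply: lt_le_trans h2 _; rewrite ler_nat ltn_ceil.
Qed.

Lemma count_upto_le (x : R) P : 0 <= x -> (count_upto x P)%:R <= x.
Proof.
move=> x0; apply: le_trans (_ : (Num.truncn x)%:R <= _); last by rewrite truncn_le.
by rewrite ler_nat; apply: leq_trans (count_size _ _) _; rewrite size_iota; lia.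
Qed.

(* Friability at level x^(1/s) in a form that makes sense at s = 0. *)
Definition psi (x s : R) : nat := count_upto x (fun n => (max_pdiv n)%:R `^ s <= x).

Lemma psi_le (x s t : R) : s <= t -> (psi x t <= psi x s)%N.
Proof.
move=> st; apply: sub_count => n /=; apply: le_trans.
by rewrite ler_powR// ler1n max_pdiv_gt0.
Qed.

(** Buchstab's identity: the integers lost from s to t are sorted by their largest prime factor p,
    and written p m with all prime factors of m at most p. *)
Lemma psi_buchstab (x s t : R) : 1 <= s -> s <= t -> 1 <= x ->
  psi x s = (psi x t + \sum_(1 <= p < (Num.truncn x).+1 | prime p && block x s t p)
     count_upto (x / p%:R) (fun m => max_pdiv m <= p)%N)%N.
Proof.
move=> s1 st x1; set T := Num.truncn x.
pose Q n := (0 < n <= T)%N && block x s t (max_pdiv n).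
have -> : psi x s = (psi x t + count Q (index_iota 1 T.+1))%N.
  rewrite /psi /count_upto -/T.
  have : all (fun n => 0 < n <= T)%N (index_iota 1 T.+1).
    by apply/allP => i; rewrite mem_index_iota ltnS.
  elim: (index_iota _ _) => [//|n r IHr] /= /andP[n0 r0]; rewrite IHr// /Q n0/=.
  suff -> : nat_of_bool ((max_pdiv n)%:R `^ s <= x) =
     (nat_of_bool ((max_pdiv n)%:R `^ t <= x)%R + block x s t (max_pdiv n))%N by lia.
  rewrite /block ltNge; case: (boolP (_ `^ t <= x)) => [h|_]; last by rewrite andbT.
  rewrite andbF addn0 (le_trans _ h)//.
  by rewrite ler_powR// ler1n max_pdiv_gt0.
have Qpr n : Q n -> prime (max_pdiv n) /\ (max_pdiv n <= T)%N.
  move=> /andP[/andP[n0 nT]] /andP[_].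
  (* The integer 1 lies in no block: P^+(1) = 1 would give x < 1. *)
  have [n1|n1] := leqP n 1.
    have -> : n = 1%N by lia.
    by rewrite /max_pdiv/= powR1; lra.
  by split; [exact: max_pdiv_prime | exact: leq_trans (max_pdiv_leq n0) nT].
congr (_ + _)%N; rewrite (@count_fiberwise _ _ _ (index_iota 1 T.+1) max_pdiv Q) ?iota_uniq//; last first.
  by move=> n /Qpr[/prime_gt0 ? ?]; rewrite mem_index_iota ltnS; lia.
rewrite [RHS]big_mkcond/=; apply: eq_big_nat => p /andP[p0 pT].
case: ifPn => [/andP[pp bp]|npb]; last first.
  apply/eqP; rewrite -leqn0 leqNgt -has_count; apply/hasPn => n _.
  apply/negP => /andP[Qn /eqP e]; move: npb; rewrite -e; have [-> _] := Qpr _ Qn.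
  by move/andP: Qn => [_ ->].
rewrite /count_upto truncn_div//; last lra.
transitivity (count (fun n => (p %| n)%N && ((0 < n)%N && (max_pdiv n == p))) (index_iota 1 T.+1)).
  apply: eq_in_count => n; rewrite mem_index_iota ltnS => nT; rewrite /Q nT/=.
  move/andP: nT => [-> _]/=.
  case: (eqVneq (max_pdiv n) p) => [e|_]; last by rewrite !andbF.
  by rewrite e bp -e max_pdiv_dvd.
rewrite count_multiples//; apply: eq_in_count => m; rewrite mem_index_iota => /andP[m0 _].
by rewrite muln_gt0 p0 m0/= max_pdiv_primeM.
Qed.

(** From p^s <= x comes p^(s-1) <= x/p, so the cofactors are friable for x/p at parameter s - 1. The
    next lemma is the converse bound: x < p^t gives x/p < p^(t-1). The fibres are thus squeezed
    between the parameters t - 1 and s - 1. *)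
Lemma block_fiber_le (x s t : R) p : (0 < p)%N -> 1 <= s -> block x s t p ->
  (count_upto (x / p%:R) (fun m => max_pdiv m <= p)%N <= psi (x / p%:R) (s - 1))%N.
Proof.
move=> p0 s1 /andP[ps _]; apply: sub_count => m mp /=.
have p0' : 0 < p%:R :> R by rewrite ltr0n.
rewrite ler_pdivlMr// (le_trans _ ps)// -(@mulr_powRB1 _ p%:R s) ?(ltW p0')//; last lra.
rewrite mulrC ler_pM2l// ge0_ler_powR// ?nnegrE//; first lra.
by rewrite ler_nat.
Qed.

Lemma block_fiber_ge (x s t : R) p : (0 < p)%N -> 1 < t -> block x s t p ->
  (psi (x / p%:R) (t - 1) <= count_upto (x / p%:R) (fun m => max_pdiv m <= p)%N)%N.
Proof.
move=> p0 t1 /andP[_ pt]; apply: sub_count => m mp /=.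
have p0' : 0 < p%:R :> R by rewrite ltr0n.
rewrite leqNgt; apply/negP => pm; move: mp; apply/negP; rewrite -ltNge.
rewrite ltr_pdivrMr// (lt_le_trans pt)// -(@mulr_powRB1 _ p%:R t) ?(ltW p0')//; last lra.
rewrite mulrC ler_pM2r// ge0_ler_powR// ?nnegrE//; first lra.
by rewrite ler_nat ltnW.
Qed.

Lemma psi_small (x s : R) : 1 <= x -> 0 <= s <= 1 -> psi x s = Num.truncn x.
Proof.
move=> x1 /andP[s0 s1]; rewrite /psi /count_upto.
rewrite -[RHS](_ : size (index_iota 1 (Num.truncn x).+1) = _); last by rewrite size_iota; lia.
apply/eqP; rewrite -all_count; apply/allP => n; rewrite mem_index_iota ltnS => /andP[n0 nx] /=.
have P1 : 1 <= (max_pdiv n)%:R :> R by rewrite ler1n max_pdiv_gt0.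
apply: le_trans (ler1_powR P1 s1) _; apply: le_trans (_ : n%:R <= _).
  by rewrite ler_nat max_pdiv_leq.
by rewrite -truncn_ge_nat//; lra.
Qed.

Lemma near_limit_ler (f g : R -> R) l l' : near_limit f l 0 -> near_limit g l' 0 ->
  (\forall x \near +oo, f x <= g x) -> l <= l'.
Proof.
move=> fl gl fg; apply/ler_addgt0Pr => e e0; have e2 : 0 < e / 2 by lra.
have [x] := filter_ex (filterI fg (filterI (fl _ e2) (gl _ e2))).
by move=> -[? [/=]]; rewrite !ler_norml => /andP[? ?] /andP[? ?]; lra.
Qed.

Lemma near_pinfty_ge (M : R) : \forall x \near +oo, M <= x.
Proof. by apply: nbhs_pinfty_ge; rewrite num_real. Qed.

Lemma near_powR_ge (M r : R) : 0 < r -> \forall x \near +oo, M <= x `^ r.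
Proof.
move=> r0; near=> x; have x0 : 0 <= x by near: x; apply: near_pinfty_ge.
have xM : `|M| `^ r^-1 <= x by near: x; apply: near_pinfty_ge.
apply: le_trans (ler_norm M) _.
have := powR_inv_le (_ : 0 < r^-1) (normr_ge0 M) x0; rewrite invr_gt0 => /(_ r0).
by rewrite xM invrK => <-.
Unshelve. all: end_near. Qed.

Lemma near_limit_const (l : R) : near_limit (fun=> l) l 0.
Proof. by move=> e e0; near=> x; rewrite subrr normr0 add0r ltW. Unshelve. all: end_near. Qed.

(** * Induction on the parameter: comparing Psi(x, x^(1/w))/x with Dickman's function *)

Variable rho : R -> R.
Hypothesis rhoD : is_Dickman rho.

Let dickman_at w := near_limit (fun x => (psi x w)%:R / x) (rho w) 0.

Lemma dickman_at_small w : 0 <= w <= 1 -> dickman_at w.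
Proof.
have [_ _ rho1 _] := rhoD; move=> w01 e e0; rewrite rho1//; near=> x.
have x1 : 1 <= x by near: x; apply: near_pinfty_ge.
have ex : e^-1 <= x by near: x; apply: near_pinfty_ge.
have /andP[h1 h2] := @truncn_itv R x ltac:(lra).
rewrite psi_small// add0r -[X in _ - X](@mulfV _ x); last lra.
rewrite -mulrBl normrM normfV (@ger0_norm _ x); last lra.
rewrite ler_pdivrMr; last lra.
move: ex; rewrite -[e^-1]mul1r ler_pdivrMr// mulrC -natr1 in h2 * => ex.
by rewrite ler_norml; apply/andP; split; lra.
Unshelve. all: end_near. Qed.

(** Monotonicity of rho, and its bounds in the next lemma, are read off from rho being a limit of
    proportions of friable integers; they are available only where the limit is already known. *)
Lemma dickman_at_antitone s t : s <= t -> dickman_at s -> dickman_at t -> rho t <= rho s.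
Proof.
move=> st ds dt; apply: near_limit_ler dt ds _; near=> x.
have x0 : 0 <= x by near: x; apply: near_pinfty_ge.
by rewrite ler_wpM2r ?invr_ge0// ler_nat psi_le.
Unshelve. all: end_near. Qed.

Lemma dickman_at_bounds s : dickman_at s -> 0 <= rho s <= 1.
Proof.
move=> ds; apply/andP; split.
  apply: near_limit_ler (@near_limit_const 0) ds _; near=> x.
  by rewrite divr_ge0//; near: x; apply: near_pinfty_ge.
apply: near_limit_ler ds (@near_limit_const 1) _; near=> x.
have x0 : 1 <= x by near: x; apply: near_pinfty_ge.
by rewrite ler_pdivrMr ?mul1r ?count_upto_le//; lra.
Unshelve. all: end_near. Qed.

(** The differential equation says that the derivative of rho with respect to ln w is -rho(w - 1);
    this is Cauchy's mean value theorem for the pair rho, ln, and it parallels Buchstab's identity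
    with ln t - ln s in place of the sum of 1/p. *)
Lemma dickman_MVT s t : 1 <= s -> s < t ->
  exists2 c, s < c < t & rho s - rho t = (ln t - ln s) * rho (c - 1).
Proof.
have [rhoC rhoDer _ rhoE] := rhoD; move=> s1 st.
have lst : 0 < ln t - ln s by rewrite subr_gt0 ltr_ln ?posrE; lra.
have [|||||c] := @cauchy_MVT R rho (derive1 rho) (@ln R) (fun x => x^-1) s t st.
- apply: continuous_subspaceW rhoC => x /=; rewrite !in_itv/= => /andP[sx xt]; lra.
- apply: continuous_in_subspaceT => x; rewrite inE/= in_itv/= => /andP[sx xt].
  by apply: continuous_ln; lra.
- move=> x; rewrite in_itv/= => /andP[sx xt].
  rewrite derive1E; apply: DeriveDef => //; apply: rhoDer; lra.
- move=> x; rewrite in_itv/= => /andP[sx xt]; apply: is_derive1_ln; lra.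
- by move=> x; rewrite in_itv/= => /andP[sx xt]; rewrite invr_eq0; lra.
rewrite in_itv/= => /andP[sc ct]; rewrite invrK => e.
exists c; first by rewrite sc.
have := rhoE c ltac:(lra); rewrite mulrC e => /eqP; rewrite addr_eq0 => /eqP h.
have -> : rho (c - 1) = - ((rho t - rho s) / (ln t - ln s)) by rewrite h opprK.
by field; lra.
Qed.

Lemma psi_drop_le x s t : 1 <= s -> s <= t -> 1 <= x ->
  (psi x s)%:R - (psi x t)%:R <= x * block_sum x s t :> R.
Proof.
move=> s1 st x1; rewrite (psi_buchstab s1 st x1) natrD addrC addKr natr_sum mulr_sumr.
by apply: ler_sum => p /andP[_ _]; rewrite count_upto_le// divr_ge0//; lra.
Qed.

(** The decreases of Psi/x and of rho both lie between 0 and about ln t - ln s. Unlike the finer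
    estimate below, this one is available at s = 1, where x/p need not tend to infinity. *)
Lemma dickman_drop_crude w s t e : 1 <= s -> s < t -> t - 1 <= w ->
  (forall w', 0 <= w' <= w -> dickman_at w') ->
  near_limit (fun x => (psi x s)%:R / x) (rho s) e ->
  near_limit (fun x => (psi x t)%:R / x) (rho t) (e + (ln t - ln s)).
Proof.
move=> s1 st tw dw H eta eta0; have e2 : 0 < eta / 2 by lra.
have [c /andP[sc ct] mvt] := dickman_MVT s1 st.
have /andP[r0 r1] : 0 <= rho (c - 1) <= 1 by apply/dickman_at_bounds/dw; lra.
have lst : 0 < ln t - ln s by rewrite subr_gt0 ltr_ln ?posrE; lra.
near=> x; have x1 : 1 <= x by near: x; apply: near_pinfty_ge.
have x0 : 0 < x by lra.
have : `|(psi x s)%:R / x - rho s| <= e + eta / 2 by near: x; apply: H.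
have : `|block_sum x s t - (ln t - ln s)| <= 0 + eta / 2.
  by near: x; apply: block_sum_limit.
have h1 : (psi x s)%:R / x - (psi x t)%:R / x <= block_sum x s t.
  by rewrite -mulrBl ler_pdivrMr// mulrC psi_drop_le// ltW.
have h2 : (psi x t)%:R / x <= (psi x s)%:R / x.
  by rewrite ler_pM2r ?invr_gt0// ler_nat psi_le// ltW.
have h3 : 0 <= (ln t - ln s) * rho (c - 1) by rewrite mulr_ge0// ltW.
have h4 : (ln t - ln s) * rho (c - 1) <= ln t - ln s by rewrite ler_piMr// ltW.
rewrite !ler_norml => /andP[? ?] /andP[? ?]; apply/andP; split; lra.
Unshelve. all: end_near. Qed.

Lemma near_limit_pinfty (f : R -> R) (l e : R) : 0 < e -> near_limit f l 0 ->
  exists M, forall X, M <= X -> `|f X - l| <= e.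
Proof.
move=> e0 /(_ _ e0)[M [_ HM]]; exists (M + 1) => X MX.
by rewrite -[e]add0r; apply: HM; lra.
Qed.

(** Arithmetic of one step. Here a and b are rho(s-1) and rho(t-1), c is the mean value between
    them, D = ln t - ln s, B is the sum of 1/p over the block, and X, Y are Psi/x at s and t. Both X
    - Y and rs - rt lie in [D b, D a] up to errors governed by eps. *)
Lemma drop_estimate (a b c D eps B X Y rs rt e eta : R) :
  0 <= eps -> eps <= 1 -> eps * (D + 2) <= eta / 2 -> 0 <= D ->
  a <= 1 -> 0 <= b -> b <= 1 -> c <= a -> b <= c -> rs - rt = D * c ->
  0 <= B -> `|B - D| <= 0 + eps -> `|X - rs| <= e + eta / 2 ->
  X - Y <= (a + eps) * B -> (b - eps) * B <= X - Y ->
  `|Y - rt| <= e + D * (a - b) + eta.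
Proof.
move=> eps0 eps1 epsE D0 a1 b0 b1 ca bc rsrt B0; rewrite !ler_norml add0r.
move=> /andP[q3 q4] /andP[q1 q2] q5 q6.
have q8 : (a + eps) * B <= (a + eps) * (D + eps) by apply: ler_wpM2l; lra.
have q9 : b * (D - eps) <= b * B by apply: ler_wpM2l; lra.
have q9' : eps * B <= eps * (D + eps) by apply: ler_wpM2l; lra.
have q10 : D * b <= D * c by rewrite ler_wpM2l.
have q11 : D * c <= D * a by rewrite ler_wpM2l.
have q12 : a * eps <= eps by rewrite ler_piMl.
have q13 : b * eps <= eps by rewrite ler_piMl.
have q14 : eps * eps <= eps by rewrite ler_piMl.
by apply/andP; split; lra.
Qed.

(** Each fibre of Buchstab's identity is x/p times a number between rho(t-1) and rho(s-1), up to
    eps. As s > 1 and p <= x^(1/s), x/p >= x^(1-1/s) tends to infinity uniformly in p, which makes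
    the approximation uniform over the block. *)
Lemma dickman_drop_fine w s t e : 1 < s -> s < t -> t - 1 <= w ->
  (forall w', 0 <= w' <= w -> dickman_at w') ->
  near_limit (fun x => (psi x s)%:R / x) (rho s) e ->
  near_limit (fun x => (psi x t)%:R / x) (rho t)
    (e + (ln t - ln s) * (rho (s - 1) - rho (t - 1))).
Proof.
move=> s1 st tw dw H eta eta0.
have [c /andP[sc ct] mvt] := dickman_MVT (ltW s1) st.
have ds : dickman_at (s - 1) by apply: dw; lra.
have dt : dickman_at (t - 1) by apply: dw; lra.
have dc : dickman_at (c - 1) by apply: dw; lra.
have /andP[a0 a1] := dickman_at_bounds ds.
have /andP[b0 b1] := dickman_at_bounds dt.
have cs : rho (c - 1) <= rho (s - 1) by apply: dickman_at_antitone => //; lra.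
have tc : rho (t - 1) <= rho (c - 1) by apply: dickman_at_antitone => //; lra.
have lst : 0 < ln t - ln s by rewrite subr_gt0 ltr_ln ?posrE; lra.
set D := ln t - ln s in lst mvt *.
(* The errors add up to at most eps (D + 1 + eps), and eps <= 1 bounds this by eps (D + 2). *)
pose eps := Num.min 1 (eta / (2 * (D + 2))).
have eps0 : 0 < eps by rewrite /eps lt_min ltr01 divr_gt0//; lra.
have eps1 : eps <= 1 by rewrite /eps ge_min lexx.
have epsE : eps * (D + 2) <= eta / 2.
  have -> : eta / 2 = eta / (2 * (D + 2)) * (D + 2) by field; lra.
  by rewrite ler_pM2r ?ge_min ?lexx ?orbT//; lra.
have [M1 HM1] := near_limit_pinfty eps0 ds.
have [M2 HM2] := near_limit_pinfty eps0 dt.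
near=> x; have x1 : 1 <= x by near: x; apply: near_pinfty_ge.
have x0 : 0 < x by lra.
have xM : Num.max M1 M2 <= x `^ (1 - s^-1).
  near: x; apply: near_powR_ge; rewrite subr_gt0 invf_lt1//; lra.
have h0 : `|(psi x s)%:R / x - rho s| <= e + eta / 2 by near: x; apply: H; lra.
have hB : `|block_sum x s t - D| <= 0 + eps by near: x; apply: block_sum_limit => //; lra.
have B0 : 0 <= block_sum x s t by apply: sumr_ge0 => p _; rewrite invr_ge0.
have xp p : prime p && block x s t p ->
    [/\ (0 < p)%N, 0 < x / p%:R, M1 <= x / p%:R & M2 <= x / p%:R].
  move=> /andP[/prime_gt0 p0 /andP[ps _]].
  have p0' : 0 < p%:R :> R by rewrite ltr0n.
  have : Num.max M1 M2 <= x / p%:R.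
    apply: le_trans xM _; rewrite powRB; last by apply/implyP => _; apply: lt0r_neq0.
    rewrite powRr1 ?(ltW x0)// ler_pM2l// lef_pV2 ?posrE ?powR_gt0//.
    by rewrite -powR_inv_le ?(ltW x0) ?(ltW p0') ?(lt_trans ltr01 s1).
  by rewrite ge_max => /andP[]; split=> //; rewrite divr_gt0.
have up : (psi x s)%:R / x - (psi x t)%:R / x <= (rho (s - 1) + eps) * block_sum x s t.
  rewrite -mulrBl ler_pdivrMr// (psi_buchstab (ltW s1) (ltW st) x1) natrD addrC addKr.
  rewrite natr_sum mulr_sumr mulr_suml; apply: ler_sum => p pb.
  have [p0 xp0 m1 m2] := xp p pb; move/andP: pb => [pp pb].
  apply: le_trans (_ : (psi (x / p%:R) (s - 1))%:R <= _).
    by rewrite ler_nat (block_fiber_le p0 (ltW s1) pb).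
  rewrite -mulrA (mulrC _^-1) -ler_pdivrMr//.
  by have := HM1 _ m1; rewrite ler_distl => /andP[].
have lo : (rho (t - 1) - eps) * block_sum x s t <= (psi x s)%:R / x - (psi x t)%:R / x.
  rewrite -mulrBl ler_pdivlMr// (psi_buchstab (ltW s1) (ltW st) x1) natrD [in leRHS]addrC addKr.
  rewrite natr_sum mulr_sumr mulr_suml; apply: ler_sum => p pb.
  have [p0 xp0 m1 m2] := xp p pb; move/andP: pb => [pp pb].
  apply: le_trans (_ : _ <= (psi (x / p%:R) (t - 1))%:R) _; last first.
    by rewrite ler_nat (block_fiber_ge p0 (lt_trans s1 st) pb).
  rewrite -mulrA (mulrC _^-1) -ler_pdivlMr//.
  by have := HM2 _ m2; rewrite ler_distl => /andP[].
exact: drop_estimate (ltW eps0) eps1 epsE (ltW lst) a1 b0 b1 cs tc mvt B0 hB h0 up lo.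
Unshelve. all: end_near. Qed.

Lemma ln_sub_le s t : 1 <= s -> s <= t -> ln t - ln s <= t - s :> R.
Proof.
move=> s1 st; have /andP[_] := @ln_diff_bounds R s t ltac:(lra) ltac:(lra).
move=> /le_trans; apply.
have -> : t / s - 1 = (t - s) / s by field; lra.
by rewrite ler_piMr ?subr_ge0// invf_le1//; lra.
Qed.

Lemma dickman_at_succ w : 1 <= w ->
  (forall w', 0 <= w' <= w -> dickman_at w') ->
  forall t, w < t <= w + 1 -> dickman_at t.
Proof.
move=> w1 dw t /andP[wt tw]; apply: near_limit0 => e e0.
(* The crude estimate from w to s costs at most s - w <= e/2. Beyond s > 1 the fine one applies, and
   its error has the form required by [creep] with g(t) = -rho(t-1). *)
pose s := Num.min (w + e / 2) ((w + t) / 2).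
have [s1 [s2 s3]] : w < s /\ s <= w + e / 2 /\ s < t.
  rewrite /s ge_min lexx lt_min gt_min; split; first by apply/andP; split; lra.
  by split=> //; apply/orP; right; lra.
have Es : near_limit (fun x => (psi x s)%:R / x) (rho s) (e / 2).
  have := @dickman_drop_crude w w s 0 w1 s1 ltac:(lra) dw (dw w ltac:(lra)).
  by apply: near_limit_le; have := ln_sub_le w1 (ltW s1); lra.
have dan a b : 0 <= a -> a <= b -> b <= w -> rho b <= rho a.
  move=> a0 ab bw; apply: dickman_at_antitone => //; apply: dw; lra.
apply: near_limit_le (_ : e / 2 + e / 2 <= e) _; first lra.
apply: (creep (E := fun t f => near_limit (fun x => (psi x t)%:R / x) (rho t) (e / 2 + f))
  (g := fun t => - rho (t - 1)) s3).
- by rewrite addr0.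
- move=> a b f sa ab bt f0 H.
  apply: near_limit_le (@dickman_drop_fine w a b _ ltac:(lra) ab ltac:(lra) dw H).
  rewrite addrA lerD2l.
  have -> : - rho (b - 1) - - rho (a - 1) = rho (a - 1) - rho (b - 1) by ring.
  apply: ler_wpM2r; last by apply: ln_sub_le; lra.
  by rewrite subr_ge0; apply: dan; lra.
- by move=> a b sa ab bt; rewrite lerN2; apply: dan; lra.
- by move=> f f' ff; apply: near_limit_le; rewrite lerD2l.
- lra.
Qed.

Theorem dickman_limit w : 0 <= w -> dickman_at w.
Proof.
suff H n w' : 0 <= w' <= n.+1%:R -> dickman_at w'.
  by move=> w0; apply: (H (Num.truncn w)); rewrite w0 ltW// truncnS_gt.
elim: n w' => [|n IHn] w'; first exact: dickman_at_small.
have [wn|wn] := leP w' n.+1%:R; first by move=> /andP[w0 _]; apply: IHn; rewrite w0.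
move=> /andP[_ wn']; apply: (@dickman_at_succ n.+1%:R); rewrite ?ler1n//.
by rewrite wn natr1.
Qed.

End Dickman.

(** * Rough integers *)

Section Rough.
Variable R : realType.
Implicit Types (z w : R) (d m p : nat).

Definition rough z d : bool := (0 < d)%N && all (fun p => z < p%:R) (primes d).

Lemma roughP z d : (0 < d)%N ->
  reflect (forall p, prime p -> (p %| d)%N -> z < p%:R) (rough z d).
Proof.
move=> d0; rewrite /rough d0 /=; apply: (iffP allP) => H p.
  by move=> pp pd; apply: H; rewrite mem_primes pp d0.
by rewrite mem_primes => /and3P[pp _ pd]; apply: H.
Qed.

Lemma rough_gt0 z d : rough z d -> (0 < d)%N. Proof. by case/andP. Qed.

Lemma rough1 z : rough z 1. Proof. by []. Qed.

Lemma rough_dvd z d m : rough z m -> (d %| m)%N -> rough z d.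
Proof.
move=> rm dm; have m0 := rough_gt0 rm; have d0 : (0 < d)%N by apply: dvdn_gt0 dm.
by apply/roughP => // p pp pd; apply: (roughP _ m0 rm) => //; apply: dvdn_trans dm.
Qed.

Lemma rough_le w z d : w <= z -> rough z d -> rough w d.
Proof.
by move=> wz /andP[d0 /allP h]; rewrite /rough d0; apply/allP => p /h; apply: le_lt_trans.
Qed.

Lemma rough_prime z p : prime p -> rough z p = (z < p%:R).
Proof. by move=> pp; rewrite /rough prime_gt0// primes_prime//= andbT. Qed.

Lemma roughM z d m : rough z d -> rough z m -> rough z (d * m).
Proof.
move=> rd rm; have d0 := rough_gt0 rd; have m0 := rough_gt0 rm.
apply/roughP => [|p pp]; first by rewrite muln_gt0 d0.
by rewrite Euclid_dvdM// => /orP[]; [apply: (roughP _ d0 rd)|apply: (roughP _ m0 rm)].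
Qed.

Lemma friableP z m : 1 <= z -> (0 < m)%N ->
  reflect (forall p, prime p -> (p %| m)%N -> p%:R <= z) (friable z m).
Proof.
move=> z1 m0; apply: (iffP idP) => [fm p pp pm|H].
  apply: le_trans fm; rewrite ler_nat; apply: max_pdiv_max.
  by rewrite mem_primes pp m0.
have [m1|m1] := leqP m 1; first by have -> : m = 1%N by lia.
by apply: H; [exact: max_pdiv_prime|exact: max_pdiv_dvd].
Qed.

Lemma dvdn_primeM_cases d p m : prime p -> (d %| p * m)%N ->
  (d %| m)%N \/ exists2 e, d = (p * e)%N & (e %| m)%N.
Proof.
move=> pp dpm; case: (boolP (p %| d)%N) => [/dvdnP[e de]|pd].
  right; exists e; first by rewrite mulnC.
  by move: dpm; rewrite de mulnC dvdn_pmul2l// prime_gt0.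
by left; rewrite -(@Gauss_dvdr d p)// coprime_sym prime_coprime.
Qed.

(** Removing a prime factor p > z divides m by more than z, and at most doubles the rough divisors:
    a divisor of p m' divides m' or is p times a divisor of m'. *)
Lemma count_rough_divisors z k m : 1 <= z -> (0 < m)%N -> m%:R < z ^+ k ->
  (count (rough z) (divisors m) <= 2 ^ k)%N.
Proof.
move=> z1; elim: k m => [|k IHk] m m0.
  by rewrite expr0 ltrn1; lia.
move=> mz; rewrite -size_filter.
have ud n : uniq [seq d <- divisors n | rough z d] by rewrite filter_uniq// divisors_uniq.
case: (boolP (has (fun p => z < p%:R) (primes m))) => [/hasP[p]|/hasPn np].
  rewrite mem_primes => /and3P[pp _ /dvdnP[m' mE]] zp.
  have p0 := prime_gt0 pp; have m'0 : (0 < m')%N by move: m0; rewrite mE; case: m' {mE}.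
  have m'z : m'%:R < z ^+ k.
    have zk : 0 <= z ^+ k by rewrite exprn_ge0//; lra.
    rewrite -(@ltr_pM2l _ z); last lra.
    rewrite -exprS; apply: le_lt_trans mz; rewrite mE natrM mulrC ler_wpM2l//.
    exact: ltW.
  set s := [seq d <- divisors m' | rough z d].
  have ss : (size s <= 2 ^ k)%N by rewrite size_filter IHk.
  apply: leq_trans (uniq_leq_size (s2 := s ++ map (muln p) s) (ud m) _) _.
    move=> d; rewrite mem_filter -dvdn_divisors// mE mulnC => /andP[rd].
    move=> /(dvdn_primeM_cases pp)[dm|[e de em]]; rewrite mem_cat; apply/orP.
      by left; rewrite mem_filter rd -dvdn_divisors.
    right; apply/mapP; exists e => //; rewrite mem_filter -dvdn_divisors// em andbT.
    by apply: rough_dvd rd _; rewrite de dvdn_mull.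
  by rewrite size_cat size_map expnS mul2n -addnn leq_add.
apply: leq_trans (uniq_leq_size (s2 := [:: 1%N]) (ud m) _) _; last by rewrite expn_gt0.
move=> d; rewrite mem_filter -dvdn_divisors// inE => /andP[rd dm].
have d0 := rough_gt0 rd; apply/negPn/negP => d1.
have d1' : (1 < d)%N by lia.
have := roughP _ d0 rd _ (pdiv_prime d1') (pdiv_dvd d); apply/negP/np.
by rewrite mem_primes pdiv_prime// m0 (dvdn_trans (pdiv_dvd d)).
Qed.

(** * Inversion over divisors and the coefficients c(d) *)

Fixpoint divisor_inversion_rec (f : nat -> R) k m : R :=
  if k is k'.+1 then
    f m - \sum_(d <- divisors m | (d < m)%N) divisor_inversion_rec f k' d
  else 0.

(** The function whose divisor sums are f, obtained by recursion on proper divisors. The second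
    argument of [divisor_inversion_rec] is fuel: every value at least m gives the same result. *)
Definition divisor_inversion f m := divisor_inversion_rec f m m.

Lemma divisors_gt0 m d : (0 < m)%N -> d \in divisors m -> (0 < d)%N.
Proof. by move=> m0; rewrite -dvdn_divisors// => dm; apply: dvdn_gt0 dm. Qed.

Lemma divisor_inversion_recE f k m : (0 < m <= k)%N ->
  divisor_inversion_rec f k m = divisor_inversion f m.
Proof.
elim/ltn_ind: m k => m IHm [|k] /andP[m0 mk]; first by lia.
rewrite /divisor_inversion; case: m => // m in IHm m0 mk *.
rewrite /=; congr (_ - _); rewrite big_seq_cond [RHS]big_seq_cond.
apply: eq_bigr => d /andP[/(divisors_gt0 m0) d0 dm].
by rewrite IHm ?IHm ?d0 //=; lia.
Qed.

Lemma sum_divisor_inversion f m : (0 < m)%N ->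
  \sum_(d <- divisors m) divisor_inversion f d = f m.
Proof.
move=> m0; rewrite (bigD1_seq m) ?divisors_uniq ?divisors_id//=.
rewrite {1}/divisor_inversion; case: m => // m in m0 *.
rewrite /= [X in _ - X + _](_ : _ = \sum_(i <- divisors m.+1 | i != m.+1) divisor_inversion f i).
  by rewrite subrK.
rewrite big_seq_cond [RHS]big_seq_cond; apply: eq_big => d.
  case: (boolP (d \in _)) => //= dm; have := dm; rewrite -dvdn_divisors// => /dvdn_leq; lia.
move=> /andP[/(divisors_gt0 m0) d0 dm]; rewrite divisor_inversion_recE//; lia.
Qed.

(* This is the Moebius function restricted to z-rough integers. *)
Definition friable_coeff z := divisor_inversion (fun m => (friable z m)%:R).

(** If p <= z divides m, then m and m/p are friable together, so the coefficients of the divisors of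
    m that do not divide m/p sum to 0. Those divisors are all multiples of p, hence all but m vanish
    by induction, and m must vanish too. *)
Lemma friable_coeff_rough z m : 1 <= z -> (0 < m)%N -> ~~ rough z m ->
  friable_coeff z m = 0.
Proof.
move=> z1; elim/ltn_ind: m => m IHm m0; rewrite /rough m0 /= -has_predC => /hasP[p].
rewrite mem_primes => /and3P[pp _ /dvdnP[m' mE]] /=; rewrite -leNgt => pz.
have p0 := prime_gt0 pp; have m'0 : (0 < m')%N by move: m0; rewrite mE; case: m' {mE}.
have m'm : (m' %| m)%N by rewrite mE dvdn_mulr.
have ltm' : (m' < m)%N by have := prime_gt1 pp; nia.
have fE : friable z m = friable z m'.
  apply/friableP/friableP => // H q qq qm; first by apply: H => //; apply: dvdn_trans m'm.
  by move: qm; rewrite mE Euclid_dvdM// => /orP[/(H _ qq)//|]; rewrite dvdn_prime2// => /eqP->.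
have := sum_divisor_inversion (fun m => (friable z m)%:R) m0.
rewrite fE -(sum_divisor_inversion (fun m => (friable z m)%:R) m'0) (bigID (fun d => d %| m')%N)/=.
have -> : \sum_(d <- divisors m | (d %| m')%N) divisor_inversion (fun m0 : nat => (friable z m0)%:R) d
  = \sum_(d <- divisors m') divisor_inversion (fun m0 : nat => (friable z m0)%:R) d.
  rewrite -big_filter; apply: perm_big; apply: uniq_perm.
  - by rewrite filter_uniq// divisors_uniq.
  - exact: divisors_uniq.
  move=> d; rewrite mem_filter -!dvdn_divisors//; case: (boolP (d %| m')%N) => //= dm.
  by rewrite (dvdn_trans dm).
rewrite -[RHS]addr0 => /addrI.
rewrite -big_filter (bigD1_seq m)/= ?filter_uniq ?divisors_uniq//; last first.
  rewrite mem_filter divisors_id// andbT.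
  by apply/negP => /(dvdn_leq m'0); lia.
rewrite big_seq_cond big1 ?addr0// => d; rewrite mem_filter.
move=> /andP[/andP[dm' dm] dNm].
have d0 := divisors_gt0 m0 dm; move: dm; rewrite -dvdn_divisors// => dm.
apply: IHm => //; first by have := dvdn_leq m0 dm; lia.
move: dm; rewrite mE mulnC => /(dvdn_primeM_cases pp)[dm|[e de em]]; first by rewrite dm in dm'.
by apply/negP => /(roughP _ d0)/(_ p pp); rewrite de dvdn_mulr// => /(_ isT); rewrite ltNge pz.
Qed.

(** A crude bound for |c(m)|, read off from the recursion; only its independence of m and z
    matters. *)
Fixpoint coeff_bound k : R := if k is k'.+1 then 1 + 2 ^+ k * coeff_bound k' else 0.

Lemma coeff_bound_ge0 k : 0 <= coeff_bound k.
Proof. by elim: k => //= k IHk; rewrite addr_ge0// mulr_ge0// exprn_ge0. Qed.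

(** For rough m, a proper divisor has a cofactor > z and is therefore below z^(k-1); at most 2^k of
    the divisors are rough, and the others contribute 0. *)
Lemma friable_coeff_bound z k m : 1 <= z -> (0 < m)%N -> m%:R < z ^+ k ->
  `|friable_coeff z m| <= coeff_bound k.
Proof.
move=> z1; elim: k m => [|k IHk] m m0; first by rewrite expr0 ltrn1; lia.
move=> mz; case: (boolP (rough z m)) => [rm|nr]; last first.
  by rewrite friable_coeff_rough// normr0 coeff_bound_ge0.
have -> : friable_coeff z m = (friable z m)%:R -
   \sum_(d <- divisors m | d != m) friable_coeff z d.
  rewrite -(sum_divisor_inversion (fun m => (friable z m)%:R) m0).
  by rewrite (bigD1_seq m) ?divisors_uniq ?divisors_id//= addrK.
apply: le_trans (ler_normB _ _) _; rewrite [leRHS]/=; apply: lerD.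
  by case: (friable z m); rewrite ?normr1 ?normr0.
apply: le_trans (ler_norm_sum _ _ _) _.
apply: le_trans (_ : \sum_(d <- divisors m | rough z d) coeff_bound k <= _).
  rewrite [leRHS]big_mkcond/= big_mkcond/= [leLHS]big_seq [leRHS]big_seq.
  apply: ler_sum => d dm; have d0 := divisors_gt0 m0 dm.
  case: ifPn => [dNm|_]; last by case: ifP => // _; apply: coeff_bound_ge0.
  case: ifPn => rd; last by rewrite friable_coeff_rough// normr0.
  apply: IHk => //; move: dm; rewrite -dvdn_divisors// => /dvdnP[e me].
  have e1 : (1 < e)%N by move: m0 dNm; rewrite me; case: e {me} => [|[|//]]; rewrite ?mul1n ?eqxx.
  have ze : z < e%:R.
    apply: lt_le_trans (_ : (pdiv e)%:R <= _).
      apply: (roughP _ m0 rm); first exact: pdiv_prime.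
      by rewrite me dvdn_mulr// pdiv_dvd.
    by rewrite ler_nat pdiv_leq//; lia.
  rewrite -(@ltr_pM2l _ z); last lra.
  rewrite -exprS; apply: le_lt_trans mz; rewrite me natrM ler_wpM2r//.
  exact: ltW.
rewrite big_const_seq iter_addr_0 -[leLHS]mulr_natl ler_wpM2r ?coeff_bound_ge0//.
by rewrite -natrX ler_nat count_rough_divisors.
Qed.

End Rough.

(** * Friable members of a sequence equidistributed in residue classes *)

Section Transfer.
Variables (R : realType) (w : R) (D : nat).
Implicit Types (d m p : nat) (r : seq nat).

Lemma sum_subrange_le (g : nat -> R) (P : pred nat) r :
  (forall d, 0 <= g d) -> uniq r ->
  (forall d, d \in r -> (0 < d <= D)%N && P d) ->
  \sum_(d <- r) g d <= \sum_(1 <= d < D.+1 | P d) g d.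
Proof.
move=> g0 ur rP.
have -> : \sum_(d <- r) g d = \sum_(1 <= d < D.+1 | d \in r) g d.
  rewrite -[RHS]big_filter; apply: perm_big; apply: uniq_perm => //.
    by rewrite filter_uniq// iota_uniq.
  move=> d; rewrite mem_filter mem_index_iota ltnS; case: (boolP (d \in r)) => //=.
  by move=> /rP/andP[->].
rewrite [leRHS]big_mkcond [leLHS]big_mkcond; apply: ler_sum => d _.
by case: (boolP (d \in r)) => [/rP/andP[_ ->]//|_]; case: ifP.
Qed.

Definition mult_count (ms : seq nat) d : nat := count (dvdn d) ms.

Variables (ms : seq nat) (N : R).

Let delta d := `|(mult_count ms d)%:R - N / d%:R|.

(** The total remainder of sieve theory, over w-rough moduli only. Applied with w <= z, it covers
    both the z-rough moduli of the friability weights and the primes, and products of two primes, of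
    the second moment. *)
Definition level_error : R := \sum_(1 <= d < D.+1 | rough w d) delta d.

Lemma level_error_ge0 : 0 <= level_error.
Proof. by apply: sumr_ge0 => d _; apply: normr_ge0. Qed.

Lemma sum_count (r : seq nat) (Q : nat -> pred nat) :
  \sum_(m <- ms) \sum_(p <- r) (Q p m)%:R = \sum_(p <- r) (count (Q p) ms)%:R :> R.
Proof.
rewrite exchange_big; apply: eq_bigr => p _; rewrite -sum1_count natr_sum [RHS]big_mkcond.
by apply: eq_bigr => m _; case: (Q p m).
Qed.

(** * Second moment of the number of prime divisors taken from r *)

Section SecondMoment.
Variables (r : seq nat) (kw : nat).
Hypotheses (w1 : 1 <= w) (ur : uniq r) (Dw : D%:R < w ^+ kw).
Hypothesis rP : forall p, p \in r -> [/\ prime p, w < p%:R & (p * p <= D)%N].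
Hypothesis r_pair : forall p q, p \in r -> q \in r -> (p * q <= D)%N.

Let L : R := \sum_(p <- r) p%:R^-1.

Let omega m : R := \sum_(p <- r) (p %| m)%N%:R.

(** A modulus d <= D comes from at most 2^kw ordered pairs: p is one of its rough divisors, and q =
    d/p. *)
Lemma sum_pair_delta :
  \sum_(p <- r) \sum_(q <- r | q != p) delta (p * q)%N <= 2 ^+ kw * level_error.
Proof.
have del0 d : 0 <= delta d by apply: normr_ge0.
apply: (@le_trans _ _ (\sum_(p <- r) \sum_(1 <= d < D.+1 | rough w d && (p %| d)%N) delta d)).
  rewrite big_seq [leRHS]big_seq; apply: ler_sum => p pr; have [pp wp _] := rP pr.
  rewrite -big_filter -(big_map (muln p) predT delta)/=.
  apply: sum_subrange_le => //.
    rewrite map_inj_uniq ?filter_uniq// => a b /eqP.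
    by rewrite eqn_pmul2l ?prime_gt0// => /eqP.
  move=> d /mapP[q]; rewrite mem_filter => /andP[_ qr] ->.
  have [qp wq _] := rP qr.
  by rewrite r_pair// muln_gt0 !prime_gt0// roughM ?rough_prime// dvdn_mulr.
under eq_bigr do rewrite big_mkcondr/=.
rewrite exchange_big/= /level_error mulr_sumr big_nat_cond [leRHS]big_nat_cond.
apply: ler_sum => d /andP[/andP[d0 dD] rd].
rewrite -big_mkcond big_const_seq iter_addr_0 -[leLHS]mulr_natl ler_wpM2r ?normr_ge0// -natrX ler_nat.
apply: leq_trans (count_rough_divisors w1 d0 (_ : d%:R < w ^+ kw)); last first.
  by apply: le_lt_trans Dw; rewrite ler_nat.
rewrite -!size_filter; apply: uniq_leq_size; first by rewrite filter_uniq.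
move=> p; rewrite !mem_filter => /andP[pd pr]; have [pp wp _] := rP pr.
by rewrite rough_prime// wp -dvdn_divisors.
Qed.

Lemma sum_delta_le : \sum_(p <- r) delta p <= level_error.
Proof.
apply: sum_subrange_le => // p; [exact: normr_ge0|move=> pr; have [pp wp ppD] := rP pr].
by rewrite rough_prime// wp prime_gt0//=; have := prime_gt0 pp; nia.
Qed.

Lemma mult_count_le d : (mult_count ms d)%:R <= N / d%:R + delta d.
Proof. by rewrite -lerBlDl ler_norm. Qed.

(** On expanding the square, the main terms N L^2 - 2 N L^2 + N L^2 cancel and the diagonal p = q
    leaves N L. The remainders are 2^kw from pairs p <> q, and 1, 2 L and L^2 from the diagonal, the
    cross term and the constant term. *)
Lemma turan_kubilius : (0 < D)%N -> 0 <= N ->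
  \sum_(m <- ms) (omega m - L) ^+ 2 <=
  N * L + (2 ^+ kw + (1 + L) ^+ 2) * level_error.
Proof.
move=> D0 N0.
have L0 : 0 <= L by apply: sumr_ge0.
have -> : \sum_(m <- ms) (omega m - L) ^+ 2 =
   \sum_(m <- ms) omega m ^+ 2 - 2 * L * \sum_(m <- ms) omega m
     + L ^+ 2 * (mult_count ms 1)%:R.
  rewrite /mult_count (eq_count (a2 := predT)); last by move=> m; rewrite dvd1n.
  rewrite count_predT -sum1_size natr_sum [2 * L * _]mulr_sumr [L ^+ 2 * _]mulr_sumr -sumrB -big_split/=.
  by apply: eq_bigr => m _; rewrite mulr1; ring.
have s1 : \sum_(m <- ms) omega m = \sum_(p <- r) (mult_count ms p)%:R.
  exact: sum_count.
have s2 : \sum_(m <- ms) omega m ^+ 2 =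
    \sum_(p <- r) \sum_(q <- r) (count (fun m => (p %| m) && (q %| m))%N ms)%:R.
  under [RHS]eq_bigr do rewrite -sum_count.
  rewrite exchange_big; apply: eq_bigr => m _.
  rewrite expr2 /omega mulr_suml; apply: eq_bigr => p _.
  rewrite mulr_sumr; apply: eq_bigr => q _.
  by case: (p %| m)%N; rewrite ?mul1r ?mul0r.
have s3 : \sum_(m <- ms) omega m ^+ 2 <=
    \sum_(m <- ms) omega m + (N * L ^+ 2 + 2 ^+ kw * level_error).
  rewrite s2 s1.
  apply: (@le_trans _ _ (\sum_(p <- r) ((mult_count ms p)%:R +
      \sum_(q <- r | q != p) (N / (p * q)%:R + delta (p * q)%N)))).
    rewrite big_seq [leRHS]big_seq; apply: ler_sum => p pr.
    rewrite (bigD1_seq p)//= lerD//.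
      by rewrite ler_nat; apply: sub_count => m /= /andP[].
    rewrite big_seq_cond [leRHS]big_seq_cond; apply: ler_sum => q /andP[qr qNp].
    apply: le_trans (mult_count_le _); rewrite ler_nat; apply: sub_count => m /= /andP[pm qm].
    have [[pp _ _] [qq _ _]] := (rP pr, rP qr).
    by rewrite Gauss_dvd ?pm ?qm// prime_coprime// dvdn_prime2// eq_sym.
  rewrite big_split/= lerD2l.
  under eq_bigr do rewrite big_split/=.
  rewrite big_split/= lerD ?sum_pair_delta//.
  rewrite expr2 {1}/L mulr_suml mulr_sumr; apply: ler_sum => p _.
  rewrite /L !mulr_sumr big_mkcond/=; apply: ler_sum => q _.
  case: ifP => _; last by rewrite !mulr_ge0// invr_ge0.
  by rewrite natrM invfM.
have s4 : \sum_(m <- ms) omega m <= N * L + level_error.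
  rewrite s1; apply: le_trans (ler_sum _ (fun p _ => mult_count_le p)) _.
  by rewrite big_split/= -mulr_sumr lerD2l sum_delta_le.
have s5 : N * L - level_error <= \sum_(m <- ms) omega m.
  rewrite s1 lerBlDr /L mulr_sumr.
  apply: le_trans (_ : \sum_(p <- r) ((mult_count ms p)%:R + delta p) <= _).
    by apply: ler_sum => p _; have := ler_norm (- ((mult_count ms p)%:R - N / p%:R)); rewrite normrN /delta; lra.
  by rewrite big_split/= lerD2l sum_delta_le.
have s6 : (mult_count ms 1)%:R <= N + level_error.
  apply: le_trans (mult_count_le _) _; rewrite divr1 lerD2l.
  have := @sum_subrange_le delta (rough w) [:: 1%N] (fun=> normr_ge0 _) isT.
  by rewrite big_seq1; apply=> d; rewrite inE => /eqP->; rewrite rough1 D0.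
have s7 : L ^+ 2 * (mult_count ms 1)%:R <= L ^+ 2 * (N + level_error).
  by rewrite ler_wpM2l// exprn_ge0.
have s8 : L * (N * L - level_error) <= L * \sum_(m <- ms) omega m.
  by rewrite ler_wpM2l.
move: s3 s4 s7 s8; set O2 := \sum_(m <- ms) omega m ^+ 2; set O := \sum_(m <- ms) omega m.
set E := level_error; set T := _%:R; set K := 2 ^+ kw.
lra.
Qed.

Definition large_rough_divisor (z : R) m : bool :=
  has (fun d => (D < d)%N && rough z d) (divisors m).

(* An integer with a z-rough divisor > D has a cofactor <= w, so that none of the
   primes of r divides it: omega vanishes there. *)
Lemma count_large_rough_divisor (z : R) : (0 < D)%N -> 0 <= N ->
  (forall p, p \in r -> p%:R <= z) ->
  (forall m, m \in ms -> (0 < m)%N && (m%:R <= w * D.+1%:R)) ->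
  L ^+ 2 * (count (large_rough_divisor z) ms)%:R <=
  N * L + (2 ^+ kw + (1 + L) ^+ 2) * level_error.
Proof.
move=> D0 N0 rz msP; apply: le_trans (turan_kubilius D0 N0).
rewrite -sum1_count natr_sum mulr_sumr [leLHS]big_mkcond/= [leLHS]big_seq [leRHS]big_seq.
apply: ler_sum => m mms; case: ifPn => [bad|_]; last by rewrite sqr_ge0.
suff -> : omega m = 0 by rewrite sub0r sqrrN mulr1.
rewrite /omega big_seq big1// => p pr; have [pp wp _] := rP pr.
have /andP[m0 mw] := msP _ mms.
case: (boolP (p %| m)%N) => // pm; exfalso.
have /hasP[d] := bad; rewrite -dvdn_divisors// => /dvdnP[e me] /andP[Dd rd].
have d0 := rough_gt0 rd.
have ndp : ~~ (p %| d)%N.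
  by apply/negP => pd; have := roughP _ d0 rd _ pp pd; rewrite ltNge rz.
have pe : (p %| e)%N by move: pm; rewrite me Euclid_dvdM// (negbTE ndp) orbF.
have e0 : (0 < e)%N by move: m0; rewrite me; case: e {me pe}.
have pE : p%:R <= e%:R :> R by rewrite ler_nat dvdn_leq.
have dE : D.+1%:R <= d%:R :> R by rewrite ler_nat.
have : p%:R * D.+1%:R <= w * D.+1%:R :> R.
  apply: le_trans mw; rewrite me natrM ler_pM//.
by rewrite ler_pM2r ?ltr0n// leNgt wp.
Qed.

End SecondMoment.

Definition friable_density (z : R) : R :=
  \sum_(1 <= d < D.+1 | rough z d) friable_coeff z d / d%:R.

(** The divisor sum of the coefficients is cut at D. The part d <= D gives the density term with
    error at most B times the level error, B bounding the coefficients; the part d > D is nonzero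
    only for m with a large rough divisor, where it has at most 2^k terms. *)
Lemma friable_count_approx (z : R) k : 1 <= w -> w <= z -> D%:R < z ^+ k ->
  (forall m, m \in ms -> (0 < m)%N && (m%:R < z ^+ k)) ->
  `|(count (friable z) ms)%:R - N * friable_density z| <=
  coeff_bound R k * (level_error + 2 ^+ k * (count (large_rough_divisor z) ms)%:R).
Proof.
move=> w1 wz Dz msP; have z1 : 1 <= z by lra.
set B := coeff_bound R k; have B0 : 0 <= B by apply: coeff_bound_ge0.
have -> : (count (friable z) ms)%:R = \sum_(m <- ms)
   (\sum_(1 <= d < D.+1 | rough z d) (d %| m)%N%:R * friable_coeff z d +
    \sum_(d <- divisors m | (D < d)%N) friable_coeff z d).
  rewrite -sum1_count natr_sum big_mkcond/= big_seq [RHS]big_seq.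
  apply: eq_bigr => m /msP/andP[m0 _].
  transitivity ((friable z m)%:R : R); first by case: (friable z m).
  rewrite -(sum_divisor_inversion (fun m => (friable z m)%:R) m0) (bigID (fun d => d <= D)%N)/=.
  congr (_ + _); last by apply: eq_bigl => d; rewrite ltnNge.
  transitivity (\sum_(1 <= d < D.+1 | (d %| m)%N) friable_coeff z d).
    rewrite -big_filter -[RHS]big_filter; apply: perm_big; apply: uniq_perm.
    - by rewrite filter_uniq// divisors_uniq.
    - by rewrite filter_uniq// iota_uniq.
    move=> d; rewrite !mem_filter mem_index_iota ltnS -dvdn_divisors//.
    by case: (boolP (d %| m)%N) => [/(dvdn_gt0 m0)->|]; rewrite ?andbF ?andbT.
  rewrite [RHS]big_mkcond [LHS]big_mkcond; apply: eq_big_nat => d /andP[d0 dD].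
  case: (boolP (rough z d)) => rd; last by rewrite friable_coeff_rough// if_same.
  by case: ifP; rewrite ?mul1r ?mul0r.
rewrite big_split/= addrAC; apply: le_trans (ler_normD _ _) _; rewrite mulrDr; apply: lerD.
  have -> : \sum_(m <- ms) \sum_(1 <= d < D.+1 | rough z d) (d %| m)%N%:R * friable_coeff z d
     - N * friable_density z =
     \sum_(1 <= d < D.+1 | rough z d) friable_coeff z d * ((mult_count ms d)%:R - N / d%:R).
    rewrite exchange_big /friable_density mulr_sumr -sumrB; apply: eq_bigr => d _.
    rewrite -mulr_suml /mult_count -sum1_count natr_sum [in RHS]big_mkcond/=.
    rewrite [X in X * _ - _](_ : _ = \sum_(m <- ms) (if (d %| m)%N then 1 else 0)); last first.
      by apply: eq_bigr => m _; case: ifP.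
    ring.
  apply: le_trans (ler_norm_sum _ _ _) _; rewrite /level_error mulr_sumr.
  rewrite [leLHS]big_mkcond [leRHS]big_mkcond/=; apply: ler_sum_nat => d /andP[d0 dD].
  case: ifP => [rd|_]; last by case: ifP => // _; rewrite mulr_ge0 ?normr_ge0.
  rewrite (rough_le wz rd) normrM ler_wpM2r// friable_coeff_bound//.
  by apply: le_lt_trans Dz; rewrite ler_nat -ltnS.
apply: le_trans (ler_norm_sum _ _ _) _.
rewrite mulrA -sum1_count natr_sum mulr_sumr [leRHS]big_mkcond/= big_seq [leRHS]big_seq.
apply: ler_sum => m /msP/andP[m0 mz]; case: ifPn => [_|/hasPn nb]; last first.
  rewrite big_seq_cond big1 ?normr0// => d /andP[dm Dd].
  rewrite friable_coeff_rough// ?(divisors_gt0 m0)//.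
  by have := nb _ dm; rewrite Dd.
rewrite mulr1; apply: le_trans (ler_norm_sum _ _ _) _.
apply: le_trans (_ : \sum_(d <- divisors m | rough z d) B <= _); last first.
  rewrite big_const_seq iter_addr_0 -[leLHS]mulr_natl [leLHS]mulrC ler_wpM2l//.
  by rewrite -natrX ler_nat count_rough_divisors.
rewrite [leRHS]big_mkcond/= big_mkcond/= [leLHS]big_seq [leRHS]big_seq.
apply: ler_sum => d dm; have d0 := divisors_gt0 m0 dm.
case: (boolP (rough z d)) => rd; last by case: ifP => // _; rewrite friable_coeff_rough// normr0.
case: ifP => // _; apply: friable_coeff_bound => //; apply: le_lt_trans mz.
by rewrite ler_nat dvdn_leq// dvdn_divisors.
Qed.

End Transfer.

(** * Level of distribution of shifted friable integers *)

Lemma leq_count_has (T U : Type) (r : seq U) (P : U -> pred T) (s : seq T) :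
  (count (fun n => has (P^~ n) r) s <= \sum_(p <- r) count (P p) s)%N.
Proof.
elim: r => [|p r IHr] /=; first by rewrite big_nil (eq_count (a2 := pred0)) ?count_pred0.
rewrite big_cons; apply: leq_trans (leq_add (leqnn _) IHr).
by rewrite -count_predUI leq_addr.
Qed.

Lemma count_dvdn_iota T d : (0 < d)%N ->
  count (dvdn d) (index_iota 1 T.+1) = (T %/ d)%N.
Proof.
move=> d0; rewrite (eq_count (a2 := fun n => (d %| n)%N && true)); last by move=> n; rewrite andbT.
by rewrite (count_multiples T predT d0) count_predT size_iota subn1.
Qed.

Lemma totient_count d : (0 < d)%N ->
  totient d = count (fun n => coprime n d) (index_iota 1 d.+1).
Proof.
case: d => // d _; rewrite totient_count_coprime -sum1_count [RHS]big_mkcond/=.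
rewrite big_ltn// [RHS]big_nat_recr//= addnC; congr (_ + _)%N; last first.
  by rewrite /coprime gcdn0 gcdnn; case: eqP.
by apply: eq_bigr => i _; rewrite coprime_sym; case: ifP.
Qed.

Section LevelError.
Variable R : realType.

(** A union bound over the primes dividing d: they are at most 2^k in number, and each exceeds w. *)
Lemma count_not_coprime (w : R) k d T : 1 <= w -> rough w d -> d%:R < w ^+ k ->
  (count (fun n => ~~ coprime n d) (index_iota 1 T.+1))%:R <= 2 ^+ k / w * T%:R.
Proof.
move=> w1 rd dw; have d0 := rough_gt0 rd; have w0 : 0 < w by lra.
apply: (@le_trans _ _ (\sum_(p <- primes d) (count (dvdn p) (index_iota 1 T.+1)))%:R).
  rewrite ler_nat; apply: leq_trans (leq_count_has _ _ _).
  rewrite -!size_filter; apply: uniq_leq_size; first by rewrite filter_uniq// iota_uniq.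
  move=> n; rewrite !mem_filter mem_index_iota => /andP[+ /andP[n0 ->]].
  rewrite n0 /= andbT.
  rewrite coprime_sym coprime_has_primes// negbK => /hasP[p]/= pn pd.
  apply/hasP; exists p => //; move: pn; rewrite mem_primes.
  by case/and3P.
rewrite natr_sum; apply: (@le_trans _ _ (\sum_(p <- primes d) T%:R / w)).
  rewrite big_seq [leRHS]big_seq; apply: ler_sum => p; rewrite mem_primes => /and3P[pp _ pd].
  have wp := roughP _ d0 rd _ pp pd; have p0 := prime_gt0 pp.
  rewrite count_dvdn_iota// ler_pdivlMr//.
  apply: (@le_trans _ _ ((T %/ p)%:R * p%:R)); first by rewrite ler_wpM2l// ltW.
  by rewrite -natrM ler_nat leq_trunc_div.
rewrite big_const_seq iter_addr_0 -[leLHS]mulr_natl count_predT.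
rewrite -[leRHS]mulrA (mulrC w^-1) ler_wpM2r ?divr_ge0 ?(ltW w0)// -natrX ler_nat.
apply: leq_trans (count_rough_divisors w1 d0 dw); rewrite -size_filter.
apply: uniq_leq_size; first exact: primes_uniq.
move=> p; rewrite mem_filter mem_primes => /and3P[pp _ pd].
by rewrite -dvdn_divisors// pd rough_prime// (roughP _ d0 rd).
Qed.

(** With nu = 2^k/w, the previous count used up to x bounds Psi - Psi_d by nu x, and used up to d it
    gives phi(d) >= (1 - nu) d. *)
Lemma Psi_coprime_approx (w x y : R) k d : 1 <= w -> rough w d -> d%:R < w ^+ k ->
  0 <= x -> 2 ^+ k / w <= 1 / 2 ->
  `|(Psi_coprime d x y)%:R / (totient d)%:R - (count_upto x (friable y))%:R / d%:R|
     <= 2 * (2 ^+ k / w) * x * d%:R^-1.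
Proof.
move=> w1 rd dw x0; set nu := 2 ^+ k / w => nu2; have d0 := rough_gt0 rd.
have nu0 : 0 <= nu by rewrite divr_ge0 ?exprn_ge0//; lra.
have dR : 0 < d%:R :> R by rewrite ltr0n.
have phi0 : 0 < (totient d)%:R :> R by rewrite ltr0n totient_gt0.
have phid : (totient d)%:R <= d%:R :> R.
  rewrite ler_nat totient_count//; apply: leq_trans (count_size _ _) _.
  by rewrite size_iota; lia.
have dphi : (1 - nu) * d%:R <= (totient d)%:R :> R.
  have := count_not_coprime d w1 rd dw; rewrite totient_count// -/nu => h.
  have : (count (fun n => coprime n d) (index_iota 1 d.+1))%:R +
    (count (fun n => ~~ coprime n d) (index_iota 1 d.+1))%:R = d%:R :> R.
    by rewrite -natrD (count_predC (fun n => coprime n d)) size_iota; congr _%:R; lia.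
  lra.
set N := (count_upto x (friable y))%:R; set P := (Psi_coprime d x y)%:R.
have N0 : 0 <= N :> R by [].
have Nx : N <= x by apply: count_upto_le.
have PN : P <= N by rewrite ler_nat; apply: sub_count => n /andP[].
have NP : N - P <= nu * x.
  apply: le_trans (_ : nu * (Num.truncn x)%:R <= _); last first.
    by rewrite ler_wpM2l// truncn_le.
  apply: le_trans (count_not_coprime (Num.truncn x) w1 rd dw).
  rewrite lerBlDr -natrD ler_nat /Psi_coprime /count_upto addnC -count_predUI.
  apply: leq_trans (leq_addr _ _); apply: sub_count => n /= fn.
  by rewrite fn/= orbN.
rewrite ler_norml; apply/andP; split.
  have h1 : P / d%:R <= P / (totient d)%:R by rewrite ler_wpM2l// lef_pV2.
  have h2 : (N - P) * d%:R^-1 <= nu * x * d%:R^-1 by rewrite ler_wpM2r// invr_ge0 ltW.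
  have h3 : 0 <= nu * x * d%:R^-1 by apply: mulr_ge0; [exact: mulr_ge0|rewrite invr_ge0 ltW].
  lra.
have h1 : P / (totient d)%:R <= N * ((1 + 2 * nu) / d%:R).
  apply: (@le_trans _ _ (N / (totient d)%:R)); first by rewrite ler_wpM2r// invr_ge0 ltW.
  rewrite ler_wpM2l// ler_pdivlMr// mulrC ler_pdivrMr//.
  (* Here 1/(1 - nu) <= 1 + 2 nu, because (1 + 2 nu)(1 - nu) = 1 + nu (1 - 2 nu) and nu <= 1/2. *)
  have : (1 + 2 * nu) * ((1 - nu) * d%:R) <= (1 + 2 * nu) * (totient d)%:R.
    by rewrite ler_wpM2l//; lra.
  have : 0 <= nu * (1 - 2 * nu) * d%:R by apply: mulr_ge0; [apply: mulr_ge0; lra|exact: ltW].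
  lra.
have h2 : N * (2 * nu / d%:R) <= x * (2 * nu / d%:R).
  by rewrite ler_wpM2r// divr_ge0//; lra.
lra.
Qed.

Lemma harmonic_le n : \sum_(1 <= d < n.+1) d%:R^-1 <= 1 + ln n%:R :> R.
Proof.
elim: n => [|n IHn]; first by rewrite big_nil ln0//; lra.
rewrite big_nat_recr//=; have [->|n0] := posnP n.
  by rewrite big_nil ln1 invr1; lra.
have n0' : 0 < n%:R :> R by rewrite ltr0n.
have n1' : 0 < n.+1%:R :> R by rewrite ltr0n.
have /andP[h _] := ln_diff_bounds n0' n1'.
have e : 1 - n%:R / n.+1%:R = n.+1%:R^-1 :> R.
  have nE : n.+1%:R = n%:R + 1 :> R by rewrite natr1.
  by move: n1'; rewrite nE => n1'; field; lra.
move: h IHn; rewrite e; set c := _^-1; set l := ln n.+1%:R; set S := \sum_(_ <= _ < _) _.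
lra.
Qed.

(** * Shifted friable integers in residue classes *)

Definition shift_seq (x y : R) (a : int) : seq nat :=
  [seq absz (n%:Z + a) | n <- index_iota 1 (Num.truncn x).+1
                       & friable y n && (0 < n%:Z + a)].

Lemma friable_shift_countE (x y z : R) a :
  friable_shift_count x y z a = count (friable z) (shift_seq x y a).
Proof.
rewrite /shift_seq count_map count_filter /friable_shift_count /count_upto.
by apply: eq_count => n /=; rewrite [RHS]andbC -andbA.
Qed.

Lemma shift_seq_bounds (x y : R) a m : 0 <= x -> m \in shift_seq x y a ->
  (0 < m)%N && (m%:R <= x + `|a|%N%:R).
Proof.
move=> x0 /mapP[n]; rewrite mem_filter mem_index_iota ltnS => /andP[/andP[_ na] /andP[n0 nx]] ->.
apply/andP; split; first by lia.
apply: (@le_trans _ _ (n + `|a|)%:R); first by rewrite ler_nat; lia.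
by rewrite natrD lerD2r -truncn_ge_nat.
Qed.

Lemma eqz_mod_dvdn (n d : nat) (a : int) :
  (n%:Z == - a %[mod d%:Z])%Z = (d %| absz (n%:Z + a)%R)%N.
Proof. by rewrite eqz_mod_dvd opprK. Qed.

(** The two counts differ only by integers n with n + a <= 0, of which there are at most |a|. *)
Lemma mult_count_shift (x y : R) a d :
  `|(mult_count (shift_seq x y a) d)%:R - (Psi_ap x y (- a) d)%:R| <= `|a|%N%:R :> R.
Proof.
have -> : mult_count (shift_seq x y a) d =
   count_upto x (fun n => [&& friable y n, 0 < n%:Z + a & (d %| absz (n%:Z + a)%R)%N]).
  rewrite /mult_count /shift_seq count_map count_filter /count_upto.
  by apply: eq_count => n /=; rewrite andbC -andbA.
rewrite /Psi_ap /count_upto; set A := count _ _; set B := count _ _.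
have AB : (A <= B)%N.
  by apply: sub_count => n /and3P[fn _ dn]; rewrite fn eqz_mod_dvdn.
have BA : (B <= A + `|a|)%N.
  apply: (@leq_trans (A + count (fun n => n <= `|a|)%N (index_iota 1 (Num.truncn x).+1))).
    rewrite /A -count_predUI; apply: leq_trans (leq_addr _ _).
    apply: sub_count => n /= /andP[fn]; rewrite eqz_mod_dvdn fn => -> /=; lia.
  rewrite leq_add2l -size_filter; apply: leq_trans (uniq_leq_size (s2 := iota 1 `|a|) _ _) _.
  - by rewrite filter_uniq// iota_uniq.
  - by move=> n; rewrite mem_filter mem_index_iota mem_iota; lia.
  - by rewrite size_iota.
rewrite distrC ger0_norm ?subr_ge0 ?ler_nat//.
by rewrite lerBlDr -natrD ler_nat addnC.
Qed.

Lemma discrepancy_le (x y : R) (b : int) q : coprimez b q%:Z ->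
  ((`|(Psi_ap x y b q)%:R - (Psi_coprime q x y)%:R / (totient q)%:R|)%:E
     <= max_discrepancy x y q)%E.
Proof. by move=> bq; apply: ereal_sup_ubound; exists x, b. Qed.

Lemma max_discrepancy_ge0 (x y : R) q : (0 <= max_discrepancy x y q)%E.
Proof.
by apply: le_trans (@discrepancy_le x y 1 q _); rewrite ?lee_fin ?normr_ge0// /coprimez gcd1z.
Qed.

Lemma rough_coprimez (w : R) d (a : int) : a != 0 -> `|a|%N%:R <= w -> rough w d ->
  coprimez (- a) d%:Z.
Proof.
move=> a0 aw rd; have d0 := rough_gt0 rd.
rewrite coprimezE abszN /= coprime_has_primes ?absz_gt0//; apply/hasPn => p.
rewrite /= !mem_primes => /and3P[pp _ pd]; rewrite pp absz_gt0 a0/=; apply/negP => pa.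
have := roughP _ d0 rd _ pp pd; rewrite ltNge => /negP; apply.
by apply: le_trans aw; rewrite ler_nat dvdn_leq// absz_gt0.
Qed.

Lemma sum_discrepancy_le (x y c : R) (b : int) D (P : pred nat) :
  (forall d, P d -> coprimez b d%:Z) ->
  (\sum_(1 <= q < D.+1) max_discrepancy x y q <= c%:E)%E ->
  \sum_(1 <= d < D.+1 | P d)
    `|(Psi_ap x y b d)%:R - (Psi_coprime d x y)%:R / (totient d)%:R| <= c.
Proof.
move=> bP H; rewrite -lee_fin -sumEFin; apply: le_trans H.
rewrite big_mkcond/=; apply: lee_sum => d _.
by case: ifP => Pd; [apply: discrepancy_le; apply: bP|apply: max_discrepancy_ge0].
Qed.

Lemma near_ln_powR (eta r : R) : 0 < r -> 0 < eta ->
  \forall x \near +oo, ln x / x `^ r <= eta.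
Proof.
move=> r0 eta0; near=> x.
have x1 : 1 <= x by near: x; apply: near_pinfty_ge.
have x0 : 0 < x by lra.
have h : 2 / (r * eta) <= x `^ (r / 2) by near: x; apply: near_powR_ge; lra.
have p0 : 0 < x `^ (r / 2) by apply: powR_gt0.
have -> : x `^ r = x `^ (r / 2) * x `^ (r / 2).
  by rewrite -powRD ?lt0r_neq0 ?implybT// -splitr.
have l1 : r / 2 * ln x <= x `^ (r / 2).
  by rewrite -ln_powR ltW// ln_sublinear.
rewrite ler_pdivrMr ?mulr_gt0//.
have h2 : 2 / r <= eta * x `^ (r / 2).
  move: h; rewrite invfM mulrA ler_pdivrMr// mulrC.
  by rewrite (mulrC eta).
have h3 : ln x <= 2 / r * x `^ (r / 2).
  have -> : ln x = 2 / r * (r / 2 * ln x) by field; lra.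
  by rewrite ler_pM2l// divr_gt0.
apply: le_trans h3 _; rewrite mulrA ler_pM2r//.
Unshelve. all: end_near. Qed.

Lemma near_inv_powR (K eta r : R) : 0 < r -> 0 < eta ->
  \forall x \near +oo, K / x `^ r <= eta.
Proof.
move=> r0 eta0; near=> x.
have x0 : 1 <= x by near: x; apply: near_pinfty_ge.
have h : K / eta <= x `^ r by near: x; apply: near_powR_ge.
have xr : 0 < x `^ r by apply: powR_gt0; lra.
by rewrite ler_pdivrMr// mulrC -ler_pdivrMr.
Unshelve. all: end_near. Qed.

Lemma lt_powR_level (x e r : R) : 1 < x -> 0 < e -> 0 < r ->
  (Num.truncn (x `^ (1 - e)))%:R < (x `^ r) ^+ (Num.truncn r^-1).+1.
Proof.
move=> x1 e0 r0; have x0 : 0 < x by lra.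
apply: (@le_lt_trans _ _ (x `^ (1 - e))); first by rewrite truncn_le powR_ge0.
rewrite -powR_mulrn ?powR_ge0// -powRrM.
have h : 1 < r * (Num.truncn r^-1).+1%:R.
  by rewrite mulrC -ltr_pdivrMr// mul1r truncnS_gt.
rewrite -ltr_ln ?posrE ?powR_gt0// !ln_powR ltr_pM2r ?ln_gt0//; lra.
Qed.

(** The remainder at d splits into three: at most |a| for the n with n + a <= 0, in total |a|
    x^(1-e); the discrepancy of the class -a, bounded by the hypothesis; and the replacement of
    Psi_d/phi(d) by Psi/d, in total O(x (1 + ln x)/w). *)
Lemma EH_level_error (u e r eta : R) (a : int) : friable_Elliott_Halberstam R ->
  1 <= u -> a != 0 -> 0 < e < 1 -> 0 < r -> 0 < eta ->
  \forall x \near +oo, level_error (x `^ r) (Num.truncn (x `^ (1 - e)))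
     (shift_seq x (x `^ u^-1) a) (count_upto x (friable (x `^ u^-1)))%:R <= eta * x.
Proof.
move=> EH u1 a0 e01 r0 eta0; have [e0 e1] := andP e01.
(* The exponent A = 1 is enough: x/ln x is o(x). *)
have [C HC] := EH e u 1 e01 u1 ltr01.
pose k := (Num.truncn r^-1).+1.
near=> x.
have x1 : 1 < x by near: x; apply: nbhs_pinfty_gt; rewrite num_real.
have x0 : 0 < x by lra.
set w := x `^ r; set y := x `^ u^-1; set D := Num.truncn (x `^ (1 - e)).
have lx : 0 < ln x by apply: ln_gt0.
have aw : `|a|%N%:R <= w by rewrite ?/w; near: x; apply: near_powR_ge.
have w1 : 1 <= w by rewrite ?/w; near: x; apply: near_powR_ge.
have nu2 : 2 ^+ k / w <= 1 / 2 by rewrite ?/w; near: x; apply: near_inv_powR => //; lra.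
have Dw : D%:R < w ^+ k by apply: lt_powR_level.
have DX : D%:R <= x `^ (1 - e) by rewrite truncn_le powR_ge0.
have disc : \sum_(1 <= d < D.+1 | rough w d)
    `|(Psi_ap x y (- a) d)%:R - (Psi_coprime d x y)%:R / (totient d)%:R| <= C * (x / ln x `^ 1).
  apply: sum_discrepancy_le; first by move=> d; apply: rough_coprimez.
  have HCx : forall z : R, 0 < z -> ln x / ln z = u ->
    (\sum_(1 <= q < (Num.truncn (x `^ (1 - e))).+1) max_discrepancy x z q
       <= (C * (x / ln x `^ 1))%:E)%E by near: x; exact: HC.
  apply: HCx.
  - exact: powR_gt0.
  - by rewrite ln_powR; field; apply/andP; split; lra.
have dx : (ln x `^ 1) = ln x by rewrite powRr1// ltW.
have s1 : C / ln x <= eta / 4 by near: x; apply: div_ln_small; lra.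
have s2 : `|a|%N%:R / x `^ e <= eta / 4 by rewrite ?/w; near: x; apply: near_inv_powR; lra.
have s3 : 2 * 2 ^+ k / w <= eta / 4 by rewrite ?/w; near: x; apply: near_inv_powR; lra.
have s4 : ln x / w <= eta / 4 / (2 * 2 ^+ k).
  by rewrite /w; near: x; apply: near_ln_powR => //; rewrite !divr_gt0 ?mulr_gt0 ?exprn_gt0.
have nu0 : 0 <= 2 ^+ k / w by rewrite divr_ge0 ?exprn_ge0 ?(le_trans ler01 w1).
have bnd : level_error w D (shift_seq x y a) (count_upto x (friable y))%:R <=
   `|a|%N%:R * D%:R + C * (x / ln x `^ 1) +
   2 * (2 ^+ k / w) * x * \sum_(1 <= d < D.+1) d%:R^-1.
  apply: (@le_trans _ _ (\sum_(1 <= d < D.+1 | rough w d) (`|a|%N%:R +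
    `|(Psi_ap x y (- a) d)%:R - (Psi_coprime d x y)%:R / (totient d)%:R| +
     2 * (2 ^+ k / w) * x * d%:R^-1))).
    rewrite /level_error big_nat_cond [leRHS]big_nat_cond.
    apply: ler_sum => d /andP[/andP[d0 dD] rd].
    have dw : d%:R < w ^+ k by apply: le_lt_trans Dw; rewrite ler_nat -ltnS.
    have h1 := mult_count_shift x y a d.
    have h2 := @Psi_coprime_approx w x y k d w1 rd dw (ltW x0) nu2.
    have -> : (mult_count (shift_seq x y a) d)%:R - (count_upto x (friable y))%:R / d%:R =
      ((mult_count (shift_seq x y a) d)%:R - (Psi_ap x y (- a) d)%:R) +
      ((Psi_ap x y (- a) d)%:R - (Psi_coprime d x y)%:R / (totient d)%:R) +
      ((Psi_coprime d x y)%:R / (totient d)%:R - (count_upto x (friable y))%:R / d%:R) :> R.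
      by ring.
    apply: le_trans (ler_normD _ _) _; apply: lerD h2.
    by apply: le_trans (ler_normD _ _) _; apply: lerD h1 _.
  rewrite !big_split/=; apply: lerD; first apply: lerD => //.
    rewrite big_mkcond/=; apply: (@le_trans _ _ (\sum_(1 <= d < D.+1) `|a|%N%:R)).
      by apply: ler_sum => d _; case: ifP.
    by rewrite sumr_const_nat subn1 mulr_natr.
  rewrite mulr_sumr big_mkcond/=; apply: ler_sum => d _; case: ifP => // _.
  apply: mulr_ge0; last by rewrite invr_ge0.
  by apply: mulr_ge0; [exact: mulr_ge0|exact: ltW].
apply: le_trans bnd _; rewrite dx.
have t1 : `|a|%N%:R * D%:R <= eta / 4 * x.
  apply: (@le_trans _ _ (`|a|%N%:R * x `^ (1 - e))); first by rewrite ler_wpM2l.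
  rewrite powRB; last by rewrite lt0r_neq0 ?implybT.
  rewrite powRr1 ?(ltW x0)// mulrCA mulrC ler_pM2r//.
have t2 : C * (x / ln x) <= eta / 4 * x by rewrite mulrCA mulrC ler_pM2r.
have t3 : \sum_(1 <= d < D.+1) d%:R^-1 <= 1 + ln x.
  apply: le_trans (harmonic_le D) _; rewrite lerD2l.
  have [->|D0] := posnP D; first by rewrite ln0// ltW.
  rewrite ler_ln ?posrE ?ltr0n//; apply: le_trans DX _.
  by rewrite -[leRHS]powRr1 ?(ltW x0)// ler_powR ?(ltW x1)// gerBl ltW.
have t4 : 2 * (2 ^+ k / w) * (1 + ln x) <= eta / 4 + eta / 4.
  rewrite mulrDr mulr1; apply: lerD; first by rewrite mulrA.
  rewrite -mulrA (mulrC _ (ln x)) mulrA mulrA -mulrA.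
  move: s4; rewrite ler_pdivlMr ?mulr_gt0 ?exprn_gt0//; lra.
have t5 : 2 * (2 ^+ k / w) * x * \sum_(1 <= d < D.+1) d%:R^-1 <= (eta / 4 + eta / 4) * x.
  apply: (@le_trans _ _ (2 * (2 ^+ k / w) * x * (1 + ln x))).
    by rewrite ler_wpM2l//; apply: mulr_ge0; [exact: mulr_ge0|exact: ltW].
  by rewrite mulrAC ler_pM2r.
lra.
Unshelve. all: end_near. Qed.

(** Each remainder is at most 1, and there are at most x^(1-e) moduli. *)
Lemma interval_level_error (e r eta : R) : 0 < e < 1 -> 0 < eta ->
  \forall x \near +oo, level_error (x `^ r) (Num.truncn (x `^ (1 - e)))
     (index_iota 1 (Num.truncn x).+1) x <= eta * x.
Proof.
move=> /andP[e0 e1] eta0; near=> x.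
have x1 : 1 < x by near: x; apply: nbhs_pinfty_gt; rewrite num_real.
have x0 : 0 < x by lra.
set D := Num.truncn (x `^ (1 - e)).
have DX : D%:R <= x `^ (1 - e) by rewrite truncn_le powR_ge0.
apply: (@le_trans _ _ (\sum_(1 <= d < D.+1) 1)).
  rewrite /level_error big_mkcond/=; apply: ler_sum_nat => d /andP[d0 _]; case: ifP => // _.
  rewrite /mult_count count_dvdn_iota// -truncn_div ?(ltW x0)//.
  have /andP[h1 h2] : (Num.truncn (x / d%:R))%:R <= x / d%:R < (Num.truncn (x / d%:R)).+1%:R.
    by apply: truncn_itv; rewrite divr_ge0// ltW.
  by rewrite -natr1 in h2; rewrite ler_norml; apply/andP; split; lra.
rewrite sumr_const_nat subn1/=; apply: le_trans DX _.
rewrite powRB; last by rewrite lt0r_neq0 ?implybT.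
rewrite powRr1 ?(ltW x0)// mulrC ler_pM2r// -[_^-1]mul1r.
by near: x; apply: near_inv_powR.
Unshelve. all: end_near. Qed.

End LevelError.

(** * Comparison with an interval *)

Section Assembly.
Variable R : realType.

Lemma thirds_le (e c : R) : e <= 1 / 3 -> c <= 3^-1 -> c + c <= 1 - e.
Proof. lra. Qed.

Section Pointwise.
Variables (x v t e : R).
Hypotheses (v1 : 1 <= v) (vt : 3 * v < t) (et : 2 * e = t^-1) (e0 : 0 < e)
  (e3 : e <= 1 / 3) (x2 : 2 < x) (xe2 : 2 <= x `^ e).

(** The factor 3 makes the primes of r at most x^(1/3), so that products of two are at most D, and
    at most z, so that they divide no z-rough integer. The exponent 2 e of w leaves one factor x^e
    for the gap between x and D and one for the constant in m <= 2 x. Finally k is such that z^k >=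
    x^2 > 2 x. *)
Let s := 3 * v.
Let w := x `^ (2 * e).
Let D := Num.truncn (x `^ (1 - e)).
Let z := x `^ v^-1.
Let k := (Num.truncn (2 * v)).+1.
Let kw := (Num.truncn (2 * e)^-1).+1.
Let r := [seq p <- index_iota 1 (Num.truncn x).+1 | prime p && block x s t p].

Let x1 : 1 < x. Proof. by apply: lt_trans x2; rewrite ltr1n. Qed.
Let x1' : 1 <= x. Proof. exact: ltW. Qed.
Let x0 : 0 < x. Proof. exact: lt_trans x1. Qed.
Let v0 : 0 < v. Proof. exact: lt_le_trans v1. Qed.
Let s0 : 0 < s. Proof. by rewrite mulr_gt0. Qed.
Let t0 : 0 < t. Proof. exact: lt_trans vt. Qed.
Let vs : v <= s. Proof. by rewrite /s ler_peMl ?(ltW v0)// ler1n. Qed.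
Let e2 : 0 < 2 * e. Proof. by rewrite mulr_gt0. Qed.
Let e1 : 0 < 1 - e. Proof. by rewrite subr_gt0 (le_lt_trans e3)// ltr_pdivrMr// mul1r ltr1n. Qed.

Let w1 : 1 <= w. Proof. by rewrite -[leLHS](powRr0 x) ler_powR// ltW. Qed.

Let D0 : (0 < D)%N.
Proof. by rewrite truncn_gt0 -[leLHS](powRr0 x) ler_powR// ltW. Qed.

Let Dpow : D%:R <= x `^ (1 - e). Proof. by rewrite truncn_le powR_ge0. Qed.

Let Dx : D%:R <= x.
Proof.
by apply: le_trans Dpow _; rewrite -[leRHS]powRr1 ?(ltW x0)// ler_powR// gerBl ltW.
Qed.

Let xD : x <= x `^ e * D.+1%:R.
Proof.
rewrite -[leLHS]powRr1 ?(ltW x0)//.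
have -> : x `^ 1 = x `^ e * x `^ (1 - e).
  by rewrite -powRD ?lt0r_neq0 ?implybT//; congr (_ `^ _); ring.
by rewrite ler_pM2l ?powR_gt0// ltW// truncnS_gt.
Qed.

Let wE : w = x `^ e * x `^ e.
Proof. by rewrite /w -powRD ?lt0r_neq0 ?implybT//; congr (_ `^ _); ring. Qed.

Let zk : 2 * x < z ^+ k.
Proof.
rewrite /z -powR_mulrn ?powR_ge0// -powRrM.
apply: (@lt_le_trans _ _ (x `^ 2%:R)).
  by rewrite powR_mulrn ?(ltW x0)// expr2 ltr_pM2r.
by rewrite ler_powR// ler_pdivlMl// mulrC ltW// truncnS_gt.
Qed.

Let Dz : D%:R < z ^+ k.
Proof.
apply: le_lt_trans zk; apply: le_trans Dx _.
by rewrite ler_peMl ?(ltW x0)// ler1n.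
Qed.

Let wz : w <= z.
Proof.
rewrite /w /z et ler_powR// lef_pV2 ?posrE//.
exact: le_trans vs (ltW vt).
Qed.

Let rP p : p \in r -> [/\ prime p, w < p%:R & p%:R <= x `^ s^-1].
Proof.
rewrite mem_filter => /andP[/andP[pp /andP[b1 b2]] _]; split=> //.
  by rewrite /w et ltNge -powR_inv_le -?ltNge// ltW.
by rewrite -powR_inv_le// ltW.
Qed.

Let r_pair p q : p \in r -> q \in r -> (p * q <= D)%N.
Proof.
move=> /rP[_ _ ps] /rP[_ _ qs]; rewrite truncn_ge_nat ?powR_ge0// natrM.
apply: le_trans (ler_pM _ _ ps qs) _ => //.
rewrite -powRD ?lt0r_neq0 ?implybT// ler_powR//.
have : s^-1 <= 3^-1 by rewrite lef_pV2 ?posrE// /s ler_peMr.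
by move/(thirds_le e3).
Qed.

Lemma friable_count_pointwise (ms : seq nat) (N : R) : 0 <= N ->
  (forall m, m \in ms -> (0 < m)%N && (m%:R <= 2 * x)) ->
  exists2 b : R, 0 <= b &
    block_sum x s t ^+ 2 * b <= N * block_sum x s t +
      (2 ^+ kw + (1 + block_sum x s t) ^+ 2) * level_error w D ms N /\
    `|(count (friable z) ms)%:R - N * friable_density D z| <=
      coeff_bound R k * (level_error w D ms N + 2 ^+ k * b).
Proof.
move=> N0 msP; exists (count (large_rough_divisor D z) ms)%:R => //.
have LE : \sum_(p <- r) p%:R^-1 = block_sum x s t by rewrite big_filter.
split; last first.
  apply: friable_count_approx => // m /msP/andP[-> m2]/=.
  exact: le_lt_trans m2 zk.
rewrite -LE; apply: count_large_rough_divisor => //.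
- by rewrite filter_uniq// iota_uniq.
- exact: lt_powR_level.
- by move=> p pr; have [? ? _] := rP pr; rewrite r_pair.
- move=> p /rP[_ _ ps]; apply: le_trans ps _; rewrite ler_powR//.
  by rewrite lef_pV2 ?posrE.
move=> m /msP/andP[-> m2]/=; apply: le_trans m2 _.
by rewrite wE -mulrA; apply: ler_pM => //; exact: ltW.
Qed.

End Pointwise.

(** Dividing by L^2 gives b <= x/L + O(E), and L >= 2 B K/tau makes B K x/L at most (tau/2) x. This
    is where a long range of primes pays. *)
Lemma second_moment_saving (tau B K c0 x L E b : R) : 0 < tau -> 0 <= B -> 0 <= K ->
  0 < c0 -> 0 < x -> 0 <= E -> 1 + 2 * B * K / tau <= L ->
  L ^+ 2 * b <= x * L + c0 * E ->
  B * (E + K * b) <= tau / 2 * x + B * (1 + K * c0) * E.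
Proof.
move=> tau0 B0 K0 c00 x0 E0 LB h1.
have BK0 : 0 <= B * K by apply: mulr_ge0.
have L1 : 1 <= L by apply: le_trans LB; rewrite lerDl divr_ge0// -?mulrA ?mulr_ge0// ltW.
have cE0 : 0 <= c0 * E by rewrite mulr_ge0// ltW.
have h2 : L * b <= x + c0 * E.
  rewrite -(@ler_pM2l _ L); last lra.
  rewrite mulrA -expr2; apply: le_trans h1 _; rewrite mulrDr (mulrC L x) lerD2l.
  by rewrite ler_peMl.
have BKL : B * K <= tau / 2 * L.
  have -> : B * K = tau / 2 * (2 * B * K / tau) by field; lra.
  by rewrite ler_wpM2l//; lra.
have BKE : 0 <= B * K * (c0 * E) by apply: mulr_ge0.
have h3 : B * K * b <= tau / 2 * x + B * K * (c0 * E).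
  rewrite -(@ler_pM2l _ L); last lra.
  have q1 : B * K * (L * b) <= B * K * (x + c0 * E) by rewrite ler_wpM2l.
  have q2 : B * K * x <= tau / 2 * L * x by rewrite ler_pM2r.
  have q3 : B * K * (c0 * E) <= L * (B * K * (c0 * E)) by rewrite ler_peMl.
  lra.
lra.
Qed.

(* The density on the right does not depend on the sequence ms, which is what
   allows shifted friable integers to be compared with an interval. *)
Lemma friable_count_equidistribution (v tau : R) : 1 <= v -> 0 < tau ->
  exists2 e : R, 0 < e < 1 &
  forall (ms : R -> seq nat) (N : R -> R),
  (forall eta, 0 < eta -> \forall x \near +oo,
     level_error (x `^ (2 * e)) (Num.truncn (x `^ (1 - e))) (ms x) (N x) <= eta * x) ->
  (\forall x \near +oo, 0 <= N x <= x) ->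
  (\forall x \near +oo, forall m, m \in ms x -> (0 < m)%N && (m%:R <= 2 * x)) ->
  \forall x \near +oo,
    `|(count (friable (x `^ v^-1)) (ms x))%:R
      - N x * friable_density (Num.truncn (x `^ (1 - e))) (x `^ v^-1)| <= tau * x.
Proof.
move=> v1 tau0; set k := (Num.truncn (2 * v)).+1.
have [B [BE B0]] : exists B, B = coeff_bound R k /\ 0 <= B.
  by eexists; split=> //; apply: coeff_bound_ge0.
have [K [KE K0]] : exists K, K = 2 ^+ k :> R /\ 0 <= K.
  by eexists; split=> //; apply: exprn_ge0.
(* The target for the sum of 1/p over the block, known only up to 1: Lam - 1 is the lower bound
   required by [second_moment_saving]. B and K depend on v alone, so there is no circularity in
   choosing e from Lam. *)
have [Lam [LamE Lam2]] : exists Lam, Lam = 2 + 2 * B * K / tau /\ 2 <= Lam.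
  by eexists; split=> //; rewrite lerDl divr_ge0// ?mulr_ge0// ltW.
(* Then ln t - ln (3 v) = Lam, and e = 1/(2t) makes w = x^(1/t) the lower end of the block. *)
have [t [tE vt]] : exists t, t = 3 * v * expR Lam /\ 3 * v < t.
  by eexists; split=> //; have := expR_ge1Dx Lam; rewrite ltr_pMr; lra.
have t3 : 3 < t by lra.
have [e [et e0 e3]] : exists e, [/\ 2 * e = t^-1, 0 < e & e <= 1 / 3].
  exists ((2 * t)^-1); split.
  - by field; lra.
  - by rewrite invr_gt0; lra.
  - by rewrite -[1 / 3]invf_div divr1 lef_pV2 ?posrE; lra.
have lst : ln t - ln (3 * v) = Lam.
  by rewrite tE lnM ?posrE ?expR_gt0//; [rewrite expRK; ring|lra].
exists e; first by apply/andP; split; lra.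
move=> ms N Herr HN Hms.
(* Since the sum L over the block is at most Lam + 1, c0 bounds the factor of the level error in the
   second moment. *)
have [c0 [c0E c00]] : exists c0 : R,
    c0 = 2 ^+ (Num.truncn (2 * e)^-1).+1 + (2 + Lam) ^+ 2 /\ 0 < c0.
  by eexists; split=> //; rewrite ltr_wpDr ?exprn_gt0// sqr_ge0.
have [c1 [c1E c10]] : exists c1, c1 = B * (1 + K * c0) + 1 /\ 0 < c1.
  by eexists; split=> //; rewrite ltr_wpDl// mulr_ge0// addr_ge0// mulr_ge0// ltW.
have eta0 : 0 < tau / (2 * c1) by rewrite divr_gt0// mulr_gt0.
near=> x.
have x2 : 2 < x by near: x; apply: nbhs_pinfty_gt; rewrite num_real.
have xe2 : 2 <= x `^ e by near: x; apply: near_powR_ge.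
have /andP[N0 Nx] : 0 <= N x <= x by near: x.
have msP : forall m, m \in ms x -> (0 < m)%N && (m%:R <= 2 * x) by near: x.
have err : level_error (x `^ (2 * e)) (Num.truncn (x `^ (1 - e))) (ms x) (N x)
    <= tau / (2 * c1) * x.
  by near: x; apply: Herr.
have hL : `|block_sum x (3 * v) t - (ln t - ln (3 * v))| <= 0 + 1.
  by near: x; apply: block_sum_limit => //; lra.
have [b b0 [bad]] := friable_count_pointwise v1 vt et e0 e3 x2 xe2 N0 msP.
move=> /le_trans; apply; rewrite -/k -BE -KE.
have E0 := level_error_ge0 (x `^ (2 * e)) (Num.truncn (x `^ (1 - e))) (ms x) (N x).
move: bad hL err E0; rewrite lst.
set L := block_sum _ _ _; set E := level_error _ _ _ _.
move=> bad hL err E0; move: hL; rewrite ler_norml => /andP[hL1 hL2].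
have x0 : 0 < x by lra.
apply: le_trans (@second_moment_saving tau B K c0 x L E b _ _ _ _ _ _ _ _) _ => //.
- lra.
- apply: le_trans bad _; apply: lerD; first by rewrite ler_wpM2r//; lra.
  by rewrite ler_wpM2r// c0E lerD2l ler_pXn2r ?nnegrE//; lra.
have h4 : c1 * E <= tau / 2 * x.
  have -> : tau / 2 * x = c1 * (tau / (2 * c1) * x) by field; lra.
  by rewrite ler_pM2l.
rewrite c1E in h4; lra.
Unshelve. all: end_near. Qed.

Lemma psi_friable (x u : R) : 0 < u -> 0 <= x ->
  psi x u = count_upto x (friable (x `^ u^-1)).
Proof. by move=> u0 x0; apply: eq_count => n; rewrite powR_inv_le. Qed.

(** G is eliminated between the estimates for C and V. Four approximations are used, each costing
    (tau/4) x because N/x and rv are at most 1. *)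
Lemma product_lower_bound (ru rv tau x C V N G : R) : 0 < tau -> 0 < x ->
  0 <= N <= x -> 0 <= rv <= 1 ->
  `|C - N * G| <= tau / 4 * x -> `|V - x * G| <= tau / 4 * x ->
  `|N / x - ru| <= 0 + tau / 4 -> `|V / x - rv| <= 0 + tau / 4 ->
  (ru * rv - tau) * x <= C.
Proof.
move=> tau0 x0 /andP[N0 Nx] /andP[rv0 rv1]; rewrite !ler_norml.
have -> : N * G = N / x * (x * G) by field; lra.
have [t4 [t4E t40]] : exists t4, t4 = tau / 4 /\ 0 < t4.
  by eexists; split=> //; rewrite divr_gt0.
have -> : tau = 4 * t4 by rewrite t4E; field.
rewrite -[4 * t4 / 4](_ : t4 = _); last by field.
have n0 : 0 <= N / x by rewrite divr_ge0// ltW.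
have n1 : N / x <= 1 by rewrite ler_pdivrMr ?mul1r.
have mx : V / x * x = V by rewrite divfK// lt0r_neq0.
move: (N / x) (V / x) (x * G) n0 n1 mx => n m g n0 n1 mx.
move=> /andP[q1 _] /andP[_ q2] /andP[q3 q4] /andP[q5 q6].
have h1 : n * (m * x - t4 * x) <= n * g by rewrite ler_wpM2l//; lra.
have h2 : n * (t4 * x) <= t4 * x by rewrite ler_piMl// ltW// mulr_gt0.
have k1 : ru * rv <= (n + t4) * rv by rewrite ler_wpM2r//; lra.
have k2 : n * rv <= n * (m + t4) by rewrite ler_wpM2l//; lra.
have k3 : t4 * rv <= t4 by rewrite ler_piMr// ltW.
have k4 : n * t4 <= t4 by rewrite ler_piMl// ltW.
have h4 : (ru * rv) * x <= (n * m + 2 * t4) * x by rewrite ler_pM2r//; lra.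
lra.
Qed.

Lemma friable_shift_lower_bound (rho : R -> R) (u v tau : R) (a : int) :
  is_Dickman rho -> 1 <= u -> 1 <= v -> a != 0 ->
  friable_Elliott_Halberstam R -> 0 < tau ->
  \forall x \near +oo, (rho u * rho v - tau) * x
     <= (friable_shift_count x (x `^ u^-1) (x `^ v^-1) a)%:R.
Proof.
move=> rhoD u1 v1 a0 EH tau0.
have t40 : 0 < tau / 4 by rewrite divr_gt0.
(* One e serves both sequences below, hence the density G is the same in both. *)
have [e e01 equi] := friable_count_equidistribution v1 t40.
have e0 : 0 < 2 * e by move: e01 => /andP[? ?]; lra.
have du := @dickman_limit R rho rhoD u ltac:(lra).
have dv := @dickman_limit R rho rhoD v ltac:(lra).
pose N (x : R) : R := (count_upto x (friable (x `^ u^-1)))%:R.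
have shifted := equi (fun x => shift_seq x (x `^ u^-1) a) N
  (fun eta => @EH_level_error R u e (2 * e) eta a EH u1 a0 e01 e0).
have interval := equi (fun x => index_iota 1 (Num.truncn x).+1) id
  (fun eta => @interval_level_error R e (2 * e) eta e01).
near=> x.
have x1 : 1 <= x by near: x; apply: near_pinfty_ge.
have x0 : 0 < x by lra.
set G := friable_density (Num.truncn (x `^ (1 - e))) (x `^ v^-1).
have S1 : `|(count (friable (x `^ v^-1)) (shift_seq x (x `^ u^-1) a))%:R - N x * G| <= tau / 4 * x.
  rewrite /G; near: x; apply: shifted.
    near=> x; have x0 : 0 <= x by near: x; apply: near_pinfty_ge.
    by rewrite ler0n count_upto_le.
  near=> x; have x0 : 0 <= x by near: x; apply: near_pinfty_ge.
  have xa : `|a|%N%:R <= x by near: x; apply: near_pinfty_ge.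
  by move=> m /(shift_seq_bounds x0)/andP[-> ?]; lra.
have S2 : `|(count_upto x (friable (x `^ v^-1)))%:R - x * G| <= tau / 4 * x.
  rewrite /G; near: x; apply: interval.
    near=> x; have x0 : 0 <= x by near: x; apply: near_pinfty_ge.
    by rewrite x0 lexx.
  near=> x; have x0 : 0 <= x by near: x; apply: near_pinfty_ge.
  move=> m; rewrite mem_index_iota ltnS => /andP[-> mx]/=.
  by move: mx; rewrite truncn_ge_nat// => mx; lra.
have S3 : `|(psi x u)%:R / x - rho u| <= 0 + tau / 4 by near: x; apply: du.
have S4 : `|(psi x v)%:R / x - rho v| <= 0 + tau / 4 by near: x; apply: dv.
rewrite psi_friable ?(lt_le_trans ltr01 u1) ?(ltW x0)// in S3.
rewrite psi_friable ?(lt_le_trans ltr01 v1) ?(ltW x0)// in S4.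
rewrite friable_shift_countE.
have N01 : 0 <= N x <= x by rewrite ler0n count_upto_le// ltW.
have rv01 : 0 <= rho v <= 1 by apply: dickman_at_bounds dv.
exact: product_lower_bound tau0 x0 N01 rv01 S1 S2 S3 S4.
Unshelve. all: end_near. Qed.

End Assembly.

Theorem mainTheorem7 (R : realType) (rho : R -> R) (u v : R) (a : int) :
  is_Dickman rho -> 1 <= u -> 1 <= v -> a != 0 ->
  friable_Elliott_Halberstam R ->
  exists2 h : R -> R, h x @[x --> +oo] --> (0 : R) &
    \forall x \near +oo,
      (rho u * rho v + h x) * x
        <= (friable_shift_count x (x `^ u^-1) (x `^ v^-1) a)%:R.
Proof.
move=> rhoD u1 v1 a0 EH.
pose c x : R := (friable_shift_count x (x `^ u^-1) (x `^ v^-1) a)%:R.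
(* The largest nonpositive choice for which the inequality holds: being nonpositive, it tends to 0
   as soon as it is eventually at least -e for each e > 0. *)
exists (fun x => Num.min 0 (c x / x - rho u * rho v)).
  apply/cvgrPdist_le => e e0; near=> x.
  have x0 : 1 <= x by near: x; apply: near_pinfty_ge.
  have h : (rho u * rho v - e) * x <= c x.
    by near: x; apply: friable_shift_lower_bound.
  have {}h : rho u * rho v - e <= c x / x by rewrite ler_pdivlMr//; lra.
  rewrite sub0r normrN; case: (leP 0 (c x / x - rho u * rho v)) => k.
    by rewrite normr0 ltW.
  by rewrite ltr0_norm//; lra.
near=> x; have x0 : 1 <= x by near: x; apply: near_pinfty_ge.
rewrite -/(c x) -ler_pdivlMr; last lra.
have : Num.min 0 (c x / x - rho u * rho v) <= c x / x - rho u * rho v.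
  by rewrite ge_min lexx orbT.
lra.
Unshelve. all: end_near. Qed.
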